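(* Let $T>0$ and let $H:[0,T]\times\mathbb{R}^n\times\mathbb{R}^n\to\mathbb{R}$ satisfy (H1)–(H4) and (HLC) (as described in the context), with functions $c(\cdot)$ and $k_R(\cdot)$ as there. Then there exist functions $f:[0,T]\times\mathbb{R}^n\times\mathbb{R}^{n+1}\to\mathbb{R}^n$ and $l:[0,T]\times\mathbb{R}^n\times\mathbb{R}^{n+1}\to\mathbb{R}$, Lebesgue measurable in $t$ for every $(x,a)\in\mathbb{R}^n\times\mathbb{R}^{n+1}$ and continuous in $(x,a)$ for every $t\in[0,T]$, such that for every $t\in[0,T]$ and $x,p\in\mathbb{R}^n$ $$H(t,x,p)=\sup_{a\in\mathbb{R}^{n+1}}\{\langle p,f(t,x,a)\rangle-l(t,x,a)\}$$ and $f(t,x,\mathbb{R}^{n+1})=\mathrm{dom}\,H^*(t,x,\cdot)$. Moreover: (A1) for every $R>0$, $t\in[0,T]$, $x,y\in \bar B_R$, $a,b\in\mathbb{R}^{n+1}$, $|f(t,x,a)-f(t,y,b)|\le 10(n+1)(k_R(t)|x-y|+|a-b|)$ and $|l(t,x,a)-l(t,y,b)|\le 10(n+1)(k_R(t)|x-y|+|a-b|)$; (A2) for every $t\in[0,T]$, $x\in\mathbb{R}^n$, $a\in\mathbb{R}^{n+1}$: $|f(t,x,a)|\le c(t)(1+|x|)$ and $-|H(t,x,0)|\le l(t,x,a)\le 2|H(t,x,0)|+2c(t)(1+|x|)+3|a|$; (A3) $a=(f(t,x,a),l(t,x,a))$ for all $a\in\mathrm{epi}\,H^*(t,x,\cdot)$,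 $t\in[0,T]$, $x\in\mathbb{R}^n$; (A4) if in addition $H$ is continuous (jointly in $(t,x,p)$), then $f$ and $l$ are continuous.
   Context: Hypotheses on $H:[0,T]\times\mathbb{R}^n\times\mathbb{R}^n\to\mathbb{R}$: (H1) $H(\cdot,x,p)$ is Lebesgue measurable for all $x,p$; (H2) $H(t,\cdot,\cdot)$ is continuous for every $t$; (H3) $H(t,x,\cdot)$ is convex for every $(t,x)$; (H4) there is a measurable $c:[0,T]\to[0,\infty)$ with $|H(t,x,p)-H(t,x,q)|\le c(t)(1+|x|)|p-q|$ for all $t,x,p,q$; (HLC) for every $R>0$ there is a measurable $k_R:[0,T]\to[0,\infty)$ with $|H(t,x,p)-H(t,y,p)|\le k_R(t)(1+|p|)|x-y|$ for all $t\in[0,T]$, $x,y\in\bar B_R$, $p\in\mathbb{R}^n$. Here $\bar B_R$ is the closed ball of radius $R$ centered at $0$. $H^*(t,x,v)=\sup_{p\in\mathbb{R}^n}\{\langle v,p\rangle-H(t,x,p)\}\in\mathbb{R}\cup\{+\infty\}$; $\mathrm{dom}\,\varphi=\{v:\varphi(v)<+\infty\}$ and $\mathrm{epi}\,\varphi=\{(v,r)\in\mathbb{R}^n\times\mathbb{R}:\varphi(v)\le r\}$. *)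

(* Defs.v *)
From mathcomp Require Import all_boot all_order all_algebra.
From mathcomp Require Import all_classical all_reals all_analysis.
Import Order.TTheory GRing.Theory Num.Theory.
Import numFieldNormedType.Exports.
Set Implicit Arguments. Unset Strict Implicit. Unset Printing Implicit Defensive.
Local Open Scope ring_scope.
Local Open Scope classical_set_scope.

(* The real line equipped with the Lebesgue (completed) sigma-algebra,
   i.e. the domain of [completed_lebesgue_measure]. *)
Definition lebR (R : realType) :=
  caratheodory_type ((@wlength R idfun)^*)%mu.

(* g is Lebesgue measurable on D (preimages of Borel sets are Lebesgue
   measurable). *)
Definition lebesgue_measurable_on (R : realType) (D : set R) (g : R -> R) :=
  @measurable_fun _ _ (lebR R) R D g.

(* Euclidean inner product and Euclidean norm on R^n (row vectors). *)
Definition dotv (R : realType) (n : nat) (u v : 'rV[R]_n) : R :=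
  \sum_(i < n) u 0 i * v 0 i.
Definition enorm (R : realType) (n : nat) (u : 'rV[R]_n) : R :=
  Num.sqrt (dotv u u).

(* Closed ball of radius r centered at 0, Euclidean norm. *)
Definition cball0 (R : realType) (n : nat) (r : R) : set 'rV[R]_n :=
  [set x | enorm x <= r].

(* Convex conjugate H^*(t,x,v) = sup_p { <v,p> - H(t,x,p) }, in \bar R. *)
Definition Hstar (R : realType) (n : nat)
  (H : R -> 'rV[R]_n -> 'rV[R]_n -> R) (t : R) (x v : 'rV[R]_n) : \bar R :=
  ereal_sup [set ((dotv v p - H t x p)%:E) | p in [set: 'rV[R]_n]].

(* dom H^*(t,x,.) *)
Definition domHstar (R : realType) (n : nat)
  (H : R -> 'rV[R]_n -> 'rV[R]_n -> R) (t : R) (x : 'rV[R]_n) : set 'rV[R]_n :=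
  [set v | (Hstar H t x v < +oo)%E].

(* epi H^*(t,x,.) as a subset of R^(n+1) = R^n x R, a = (lsubmx a, rsubmx a). *)
Definition epiHstar (R : realType) (n : nat)
  (H : R -> 'rV[R]_n -> 'rV[R]_n -> R) (t : R) (x : 'rV[R]_n)
  : set 'rV[R]_(n + 1) :=
  [set a | (Hstar H t x (lsubmx a) <= (rsubmx a 0 0)%:E)%E].

(* convexity of a real function on R^n *)
Definition convex_fun_rV (R : realType) (n : nat) (g : 'rV[R]_n -> R) :=
  forall (p q : 'rV[R]_n) (lam : R), 0 <= lam <= 1 ->
    g ((1 - lam) *: p + lam *: q) <= (1 - lam) * g p + lam * g q.

(* Main.v *)
Require Import Defs.
From mathcomp Require Import all_boot all_order all_algebra.
From mathcomp Require Import all_classical all_reals all_analysis.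
From mathcomp Require Import measurable_realfun.
From mathcomp Require Import ring lra.
Import Order.TTheory GRing.Theory Num.Theory.
Import numFieldNormedType.Exports.
Local Open Scope ring_scope.
Local Open Scope classical_set_scope.

(* Let [E] be the epigraph of [H^*(t, x, .)], a closed convex subset of
   [R^m], [m = n + 1], with metric projection [P] and distance function [d].
   The map [(f, l)(t, x, a)] is the mean of [P] over the cube centered at [a]
   of half-side [r = d(a) / sqrt m].  It lies in [E] by convexity and equals
   [a] when [a] is in [E], as then [r = 0].  It is Lipschitz in [a] since [P]
   and [d] are.  For the dependence on [E]: [b - P(b)] is the gradient of
   [d^2 / 2], so the mean over the cube of its [i]-th entry only involves the
   values of [d^2] on two opposite faces, and two sets whose distance
   functions differ by at most [eta] near [a] give means that differ by at
   most [(2 m + 1) eta].  Finally [d(b)] is the largest distance from [b] to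
   the half-spaces [{(v, r) : <v, q> - r <= H(t, x, q)}]; this turns (HLC) into
   [eta = 2 k_R(t) |x - y|], and, with [q] rational, yields measurability in
   [t].  The mean over the cube is taken as the limit of means over dyadic grids. *)

Set Implicit Arguments.
Unset Strict Implicit.

(** * Euclidean norm *)

Section euclidean.
Context {R : realType} {n : nat}.
Implicit Types (u v w : 'rV[R]_n) (a : R).

(** The nearest point [P(a)] itself will not do: it is Lipschitz in [a], but in general only Hoelder
    of exponent 1/2 in the set. The half-side [r] puts the cube inside the ball of radius [d(a)]
    around [a]. If [d(a)] is the larger of the distances of [a] to two sets, both distance functions
    are at most [2 d(a)] there, so their squares differ by at most [4 d(a) eta]; division by [2 r]
    leaves a constant independent of [a]. The other obstacle is that [b - P(b)] may be horizontal,
    in which case it is normal to no half-space of finite slope [q]. Normals are therefore tilted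
    slightly downward, and the cost of the tilt is controlled. *)

Lemma dotvE u v : dotv u v = \sum_(i < n) u 0 i * v 0 i.
Proof. by []. Qed.

Lemma dotvC u v : dotv u v = dotv v u.
Proof. by apply: eq_bigr => i _; rewrite mulrC. Qed.

Lemma dotvDl u v w : dotv (u + v) w = dotv u w + dotv v w.
Proof.
by rewrite /dotv -big_split; apply: eq_bigr => i _; rewrite mxE mulrDl.
Qed.

Lemma dotvZl a u v : dotv (a *: u) v = a * dotv u v.
Proof.
by rewrite /dotv mulr_sumr; apply: eq_bigr => i _; rewrite mxE mulrA.
Qed.

Lemma dotvDr u v w : dotv u (v + w) = dotv u v + dotv u w.
Proof. by rewrite dotvC dotvDl !(dotvC u). Qed.

Lemma dotvZr a u v : dotv u (a *: v) = a * dotv u v.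
Proof. by rewrite dotvC dotvZl dotvC. Qed.

Lemma dotvNl u v : dotv (- u) v = - dotv u v.
Proof. by rewrite -scaleN1r dotvZl mulN1r. Qed.

Lemma dotvNr u v : dotv u (- v) = - dotv u v.
Proof. by rewrite dotvC dotvNl dotvC. Qed.

Lemma dotvBl u v w : dotv (u - v) w = dotv u w - dotv v w.
Proof. by rewrite dotvDl dotvNl. Qed.

Lemma dotvBr u v w : dotv u (v - w) = dotv u v - dotv u w.
Proof. by rewrite dotvDr dotvNr. Qed.

Lemma dot0v u : dotv 0 u = 0.
Proof. by rewrite -(scale0r 0) dotvZl mul0r. Qed.

Lemma dotv0 u : dotv u 0 = 0.
Proof. by rewrite dotvC dot0v. Qed.

Lemma dotv_delta u i : dotv u (delta_mx 0 i) = u 0 i.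
Proof.
rewrite /dotv (bigD1 i)//= mxE !eqxx mulr1 big1 ?addr0// => j /negPf ji.
by rewrite mxE ji andbF mulr0.
Qed.

Lemma dotv_ge0 u : 0 <= dotv u u.
Proof. by apply: sumr_ge0 => i _; rewrite -expr2 sqr_ge0. Qed.

Lemma enorm_ge0 u : 0 <= enorm u.
Proof. exact: sqrtr_ge0. Qed.

Lemma sqr_enorm u : enorm u ^+ 2 = dotv u u.
Proof. by rewrite sqr_sqrtr// dotv_ge0. Qed.

Lemma enorm0 : enorm (0 : 'rV[R]_n) = 0.
Proof. by rewrite /enorm dotv0 sqrtr0. Qed.

Lemma enormZ a u : enorm (a *: u) = `|a| * enorm u.
Proof.
by rewrite /enorm dotvZl dotvZr mulrA -expr2 sqrtrM ?sqr_ge0// sqrtr_sqr.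
Qed.

Lemma enormN u : enorm (- u) = enorm u.
Proof. by rewrite -scaleN1r enormZ normrN normr1 mul1r. Qed.

Lemma enormB u v : enorm (u - v) = enorm (v - u).
Proof. by rewrite -enormN opprB. Qed.

Lemma enorm_entry u i : `|u 0 i| <= enorm u.
Proof.
rewrite -sqrtr_sqr ler_wsqrtr// /dotv (bigD1 i)//= -expr2 lerDl.
by apply: sumr_ge0 => j _; rewrite -expr2 sqr_ge0.
Qed.

Lemma enorm_eq0 u : enorm u = 0 -> u = 0.
Proof.
move=> u0; apply/rowP => i; rewrite mxE; apply/eqP.
by rewrite -normr_le0 -u0 enorm_entry.
Qed.

Lemma enorm_delta i : enorm (delta_mx 0 i : 'rV[R]_n) = 1.
Proof. by rewrite /enorm dotv_delta mxE !eqxx sqrtr1. Qed.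

(** Cauchy-Schwarz, from [0 <= |w|^2] with [w = enorm v *: u - enorm u *: v]. *)
Lemma dotv_le u v : dotv u v <= enorm u * enorm v.
Proof.
have [u0|u0] := eqVneq (enorm u) 0; first by rewrite (enorm_eq0 u0) dot0v enorm0 mul0r.
have [v0|v0] := eqVneq (enorm v) 0; first by rewrite (enorm_eq0 v0) dotv0 enorm0 mulr0.
have uv0 : 0 < enorm u * enorm v.
  by rewrite mulr_gt0// lt0r ?u0 ?v0 enorm_ge0.
have := dotv_ge0 (enorm v *: u - enorm u *: v).
rewrite dotvBl !dotvBr !dotvZl !dotvZr -!sqr_enorm (dotvC v u) => h.
rewrite -(ler_pM2l uv0); lra.
Qed.

Lemma normr_dotv_le u v : `|dotv u v| <= enorm u * enorm v.
Proof.
by rewrite ler_norml dotv_le andbT lerNl -dotvNl (le_trans (dotv_le _ _))// enormN.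
Qed.

Lemma enormD u v : enorm (u + v) <= enorm u + enorm v.
Proof.
rewrite -(@ler_pXn2r _ 2)// ?nnegrE ?enorm_ge0 ?addr_ge0 ?enorm_ge0//.
rewrite sqr_enorm dotvDl !dotvDr -!sqr_enorm (dotvC v u).
have := dotv_le u v; lra.
Qed.

Lemma enorm_distD w u v : enorm (u - v) <= enorm (u - w) + enorm (w - v).
Proof. by rewrite (le_trans _ (enormD _ _))// addrA subrK. Qed.

Lemma enorm_subl u v : enorm u <= enorm (u - v) + enorm v.
Proof. by rewrite (le_trans _ (enormD _ _))// subrK. Qed.

Lemma enorm_le_entries u (M : R) : 0 <= M -> (forall i, `|u 0 i| <= M) ->
  enorm u <= Num.sqrt n%:R * M.
Proof.
move=> M0 uM; rewrite -[leRHS]ger0_norm ?mulr_ge0 ?sqrtr_ge0// -sqrtr_sqr.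
rewrite ler_wsqrtr// exprMn sqr_sqrtr ?ler0n//.
rewrite [leRHS](_ : _ = \sum_(i < n) M ^+ 2); last first.
  by rewrite sumr_const card_ord mulr_natl.
apply: ler_sum => i _; rewrite -expr2 -(real_normK (num_real (u 0 i))).
by rewrite lerXn2r ?nnegrE ?normr_ge0.
Qed.

(** The topology on row vectors is that of the sup norm; the comparison here and in
    [enorm_le_mx_norm] carries neighborhoods and compactness over to [enorm]. *)
Lemma mx_norm_le_enorm u : `|u| <= enorm u.
Proof.
rewrite /Num.norm/= mx_normrE; apply/bigmax_leP; split => [|[i j] _].
  exact: enorm_ge0.
by rewrite /= (ord1 i) enorm_entry.
Qed.

Lemma entry_le_mx_norm u i : `|u 0 i| <= `|u|.
Proof.
rewrite [leRHS]/Num.norm/= mx_normrE.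
by apply/bigmax_geP; right; exists (0, i).
Qed.

Lemma enorm_le_mx_norm u : enorm u <= Num.sqrt n%:R * `|u|.
Proof. by apply: enorm_le_entries => // i; exact: entry_le_mx_norm. Qed.

Lemma near_enorm u (e : R) : 0 < e -> \forall v \near u, enorm (u - v) < e.
Proof.
move=> e0; have s0 : 0 < Num.sqrt n%:R + 1 :> R by rewrite ltr_wpDl ?sqrtr_ge0.
apply/nbhs_normP; exists (e / (Num.sqrt n%:R + 1)) => /=; first exact: divr_gt0.
move=> v /= uv; apply: le_lt_trans (enorm_le_mx_norm _) _.
have uv' : `|u - v| * (Num.sqrt n%:R + 1) < e by rewrite -ltr_pdivlMr.
apply: le_lt_trans uv'; rewrite mulrC ler_wpM2l// lerDl//.
Qed.

Lemma continuous_dotv v : continuous (dotv v).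
Proof.
move=> u; apply/(@cvgrPdist_lt _ _ _ _ (nbhs_filter u)) => e e0.
have d0 : 0 < e / (enorm v + 1) by rewrite divr_gt0// ltr_wpDl ?enorm_ge0.
apply: filterS (near_enorm u d0) => w.
rewrite ltr_pdivlMr ?ltr_wpDl ?enorm_ge0// -dotvBr => h.
rewrite (le_lt_trans (normr_dotv_le _ _))//.
by apply: le_lt_trans h; rewrite mulrC ler_wpM2l ?enorm_ge0// lerDl.
Qed.

Lemma continuous_enorm_dist v : continuous (fun u => enorm (v - u)).
Proof.
move=> u; apply/(@cvgrPdist_lt _ _ _ _ (nbhs_filter u)) => e e0.
apply: filterS (near_enorm u e0) => w.
apply: le_lt_trans; rewrite ler_norml; apply/andP; split.
  by have := enorm_distD u v w; lra.
by have := enorm_distD w v u; rewrite (enormB w u); lra.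
Qed.

End euclidean.

#[local] Opaque dotv enorm.

(** * Projection onto a closed convex set *)

(** Arithmetic of [residual_diff_quotient]: [z], [x], [y] are the entries [i] of the residual at
    [b], [b + s e_i], [b - s e_i], and [U], [V] are the squared distances at the last two points.
    Convexity puts the quotient between [y] and [x]. *)
Lemma quotient_between {R : realType} (s x y z U V : R) : 0 < s ->
  `|z - x| <= s -> `|z - y| <= s -> U + 2 * (- (2 * s) * x) <= V ->
  V + 2 * (2 * s * y) <= U -> `|z - (U - V) / (4 * s)| <= s.
Proof.
move=> s0; rewrite !ler_norml => /andP[h1 h2] /andP[h3 h4] h5 h6.
have s4 : 0 < 4 * s by lra.
have uv1 : (U - V) / (4 * s) <= x by rewrite ler_pdivrMr//; lra.
have uv2 : y <= (U - V) / (4 * s) by rewrite ler_pdivlMr//; lra.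
clear -h1 h2 h3 h4 uv1 uv2; move: (_ / _) uv1 uv2 => w uv1 uv2.
by apply/andP; split; lra.
Qed.

Section projection.
Context {R : realType} {m : nat}.
Implicit Types (C : set 'rV[R]_m) (a b z : 'rV[R]_m).

Definition closed_convex C :=
  [/\ C !=set0, closed C &
      forall x y (s : R), C x -> C y -> 0 <= s <= 1 -> C ((1 - s) *: x + s *: y)].

(** The default [0] is taken only if there is no nearest point, which [projP] excludes for closed
    convex sets. *)
Definition proj C b : 'rV[R]_m :=
  xget 0 [set z | C z /\ forall y, C y -> enorm (b - z) <= enorm (b - y)].

Definition dist C b : R := enorm (b - proj C b).

Lemma distE C b : dist C b = enorm (b - proj C b).
Proof. by []. Qed.

(** Only the points of [C] no farther from [b] than [z0] compete, and they form a compact set. *)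
Lemma nearest_point_exists C b : C !=set0 -> closed C ->
  exists z, C z /\ forall y, C y -> enorm (b - z) <= enorm (b - y).
Proof.
move=> [z0 Cz0] clC; pose r := enorm (b - z0).
pose K := C `&` [set z | enorm (b - z) <= r].
have clK : closed K.
  apply: closedI => //; apply: (@closed_comp _ _ _ [set s | s <= r]).
    by move=> z _; exact: continuous_enorm_dist.
  exact: closed_le.
have bdK : bounded_set K.
  exists (r + enorm b); split; first exact: num_real.
  move=> M rM z [_ /= bz]; apply: le_trans (mx_norm_le_enorm _) _.
  apply: le_trans (ltW rM); have := enorm_subl z b.
  by rewrite (enormB z b); lra.
have cK : {within K, continuous (fun z => enorm (b - z))}.
  by apply: continuous_subspaceT => z; exact: continuous_enorm_dist.
have K0 : K !=set0 by exists z0; split=> //=; exact: lexx.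
have [z /set_mem[Cz zr] zmin] := EVT_min_rV K0 (bounded_closed_compact bdK clK) cK.
exists z; split=> // y Cy; have [yr|/ltW yr] := leP (enorm (b - y)) r.
  by apply: zmin; rewrite inE.
by apply: le_trans yr.
Qed.

Section fixed_set.
Variables (C : set 'rV[R]_m) (hC : closed_convex C).

Lemma projP b :
  C (proj C b) /\ forall y, C y -> enorm (b - proj C b) <= enorm (b - y).
Proof.
rewrite /proj; case: hC => C0 clC _.
case: xgetP => [z _ //|noz]; have [z hz] := nearest_point_exists b C0 clC.
by case: (noz z).
Qed.

Lemma proj_in b : C (proj C b). Proof. by case: (projP b). Qed.

Lemma dist_le b y : C y -> dist C b <= enorm (b - y).
Proof. by case: (projP b) => _; exact. Qed.

Lemma dist_ge0 b : 0 <= dist C b. Proof. exact: enorm_ge0. Qed.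

Lemma dist_eq0 b : dist C b = 0 -> proj C b = b.
Proof. by move/enorm_eq0/subr0_eq. Qed.

Lemma dist_in b : C b -> dist C b = 0.
Proof.
move=> /(dist_le b); rewrite subrr enorm0 => d0.
by apply/eqP; rewrite eq_le d0 dist_ge0.
Qed.

#[local] Opaque proj.

Lemma proj_dot b y : C y -> dotv (b - proj C b) (y - proj C b) <= 0.
Proof.
move=> Cy; rewrite leNgt; apply/negP => D0.
have Cs (s : R) : 0 <= s <= 1 -> C ((1 - s) *: proj C b + s *: y).
  by case: hC => _ _; apply=> //; exact: proj_in.
have nearest (s : R) : 0 <= s <= 1 -> dotv (b - proj C b) (b - proj C b) <=
    dotv ((b - proj C b) - s *: (y - proj C b)) ((b - proj C b) - s *: (y - proj C b)).
  move=> /Cs /(projP b).2; rewrite -(@ler_pXn2r _ 2)// ?nnegrE ?enorm_ge0// !sqr_enorm.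
  congr (_ <= dotv _ _); apply/rowP => j; rewrite !mxE; ring.
move: D0 nearest; move: (b - _) (y - _) => g d; set D := dotv g d => D0 nearest.
pose Q := dotv d d; have Q0 : 0 <= Q by exact: dotv_ge0.
have QD : 0 < Q + D by lra.
(* A step [s] toward [y] changes the squared distance by [s^2 Q - 2 s D], which is negative here
   because [s Q <= D < 2 D]. *)
pose s := D / (Q + D); have s0 : 0 < s by rewrite divr_gt0.
have sQD : s * (Q + D) = D by rewrite /s divfK// gt_eqF.
have := nearest s; rewrite (ltW s0) {1}/s ler_pdivrMr// mul1r lerDr Q0.
move=> /(_ isT); rewrite dotvBl !dotvBr !dotvZl !dotvZr (dotvC d g) -/D -/Q => h.
have h2 : s * (2 * D) <= s * (s * Q) by lra.
rewrite (ler_pM2l s0) in h2.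
have : s * Q <= D by rewrite -[leRHS]sQD ler_wpM2l ?(ltW s0)//; lra.
lra.
Qed.

(** The inequalities [proj_dot] at [a] and at [b] add up to [|Pa - Pb|^2 <= <Pa - Pb, a - b>]. *)
Lemma proj_lip a b : enorm (proj C a - proj C b) <= enorm (a - b).
Proof.
have [->|P0] := eqVneq (enorm (proj C a - proj C b)) 0; first exact: enorm_ge0.
rewrite -(@ler_pM2l _ (enorm (proj C a - proj C b))) ?lt0r ?P0 ?enorm_ge0//.
apply: le_trans (dotv_le _ _); rewrite -expr2 sqr_enorm.
have := proj_dot a (proj_in b); have := proj_dot b (proj_in a).
rewrite !dotvBl !dotvBr (dotvC a) (dotvC a) (dotvC b) (dotvC b).
rewrite (dotvC (proj C b) (proj C a)); lra.
Qed.

Lemma dist_lip a b : `|dist C a - dist C b| <= enorm (a - b).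
Proof.
have h x y : dist C x <= enorm (x - y) + dist C y.
  exact: le_trans (dist_le _ (proj_in y)) (enorm_distD _ _ _).
rewrite ler_norml; have := h a b; have := h b a; rewrite (enormB b a).
move: (dist C a) (dist C b) (enorm _) => x y z; lra.
Qed.

Lemma dist_le_via C' b : dist C b <= dist C' b + dist C (proj C' b).
Proof.
have := dist_lip b (proj C' b); rewrite ler_norml => /andP[_].
by rewrite (distE C'); move: (dist _ _) (dist _ _) (enorm _) => x y z; lra.
Qed.

(** Firm nonexpansiveness: [|a - b|^2] exceeds the square of the left side by
    [2 <a - b, Pa - Pb> - |Pa - Pb|^2 >= 0]. *)
Lemma residual_lip a b :
  enorm ((a - proj C a) - (b - proj C b)) <= enorm (a - b).
Proof.
rewrite -(@ler_pXn2r _ 2)// ?nnegrE ?enorm_ge0// !sqr_enorm.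
have -> : (a - proj C a) - (b - proj C b) = (a - b) - (proj C a - proj C b).
  by apply/rowP => j; rewrite !mxE; ring.
have := proj_dot a (proj_in b); have := proj_dot b (proj_in a).
have := dotv_ge0 (proj C a - proj C b).
rewrite !dotvBl !dotvBr.
rewrite (dotvC a (proj _ _)) (dotvC a (proj _ _)) (dotvC b (proj _ _)).
rewrite (dotvC b (proj _ _)) (dotvC (proj C b) (proj C a)) (dotvC b a); lra.
Qed.

(** The squared distance is convex with twice the residual as subgradient: the displacement of the
    projection has the right sign by [proj_dot], and the rest is [|g' - g|^2 >= 0]. *)
Lemma sqr_dist_ge a b :
  dist C a ^+ 2 + 2 * dotv (a - proj C a) (b - a) <= dist C b ^+ 2.
Proof.
rewrite !sqr_enorm.
have := dotv_ge0 ((b - proj C b) - (a - proj C a)).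
have := proj_dot a (proj_in b).
set g := a - proj C a; set g' := b - proj C b.
have -> : b - a = (g' - g) + (proj C b - proj C a).
  by rewrite /g /g' opprB; apply/rowP => i; rewrite !mxE; lra.
clearbody g g'; rewrite (dotvDr g (g' - g)) (dotvBr g g' g) (dotvBl g' g).
by rewrite !(dotvBr _ g' g) (dotvC g' g); lra.
Qed.

Lemma sqr_dist_ge_delta a b i (s : R) : b - a = s *: delta_mx 0 i ->
  dist C a ^+ 2 + 2 * (s * (a - proj C a) 0 i) <= dist C b ^+ 2.
Proof. by move=> ab; have := sqr_dist_ge a b; rewrite ab dotvZr dotv_delta. Qed.

Lemma residual_entry_lip a b i :
  `|(a - proj C a) 0 i - (b - proj C b) 0 i| <= enorm (a - b).
Proof.
apply: le_trans (residual_lip a b).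
by have := enorm_entry ((a - proj C a) - (b - proj C b)) i; rewrite !mxE.
Qed.

(* [b - proj C b] is the gradient of half the squared distance. *)
Lemma residual_diff_quotient b i (s : R) : 0 < s ->
  `|(b - proj C b) 0 i - (dist C (b + s *: delta_mx 0 i) ^+ 2 -
       dist C (b - s *: delta_mx 0 i) ^+ 2) / (4 * s)| <= s.
Proof.
move=> s0.
have enorme : enorm (s *: delta_mx 0 i : 'rV[R]_m) = s.
  by rewrite enormZ gtr0_norm// enorm_delta mulr1.
have := residual_entry_lip b (b + s *: delta_mx 0 i) i.
have := residual_entry_lip b (b - s *: delta_mx 0 i) i.
have := @sqr_dist_ge_delta (b + s *: delta_mx 0 i) (b - s *: delta_mx 0 i) i (- (2 * s)).
have := @sqr_dist_ge_delta (b - s *: delta_mx 0 i) (b + s *: delta_mx 0 i) i (2 * s).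
have bpm (x : 'rV[R]_m) : b + x - (b - x) = 2 *: x.
  by rewrite opprB addrC addrA subrK -mulr2n -scaler_nat.
have bp (x : 'rV[R]_m) : b - (b + x) = - x by rewrite opprD addrA subrr add0r.
rewrite subKr bp enormN enorme.
rewrite bpm scalerA => /(_ erefl) h5.
rewrite -[X in X = - (2 * s) *: _]opprB bpm scalerA scaleNr => /(_ erefl) h6.
move: h5 h6.
move=> h5 h6 h2 h1; move: h1 h2 h6 h5.
exact: quotient_between.
Qed.

End fixed_set.
End projection.

(** * Means over the unit cube *)

Lemma cvg_half_pow {R : realType} (c : R) : (fun K => c * 2^-1 ^+ K) @ \oo --> (0 : R).
Proof.
by apply: cvg_geometric; rewrite ger0_norm ?invr_ge0// invf_lt1// ltr1n.
Qed.

Lemma le_half_pow {R : realType} (x y c : R) :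
  (forall K : nat, x <= y + c * 2^-1 ^+ K) -> x <= y.
Proof.
move=> h; rewrite -subr_le0; apply: (cvgr_to_ge (cvg_half_pow c)).
by apply: nearW => K; rewrite lerBlDl.
Qed.

(** The sequence [v k + c * 2^-1 ^+ k] is nonincreasing both for [v = u] and for [v = - u]; this
    gives convergence and the two halves of the estimate. *)
Lemma half_pow_cauchy {R : realType} (u : nat -> R) (c : R) K : 0 <= c ->
  (forall k, `|u k.+1 - u k| <= c * 2^-1 ^+ k.+1) ->
  `|u K - lim (u @ \oo)| <= c * 2^-1 ^+ K.
Proof.
move=> c0 uk.
have key (v : nat -> R) : (forall k, `|v k.+1 - v k| <= c * 2^-1 ^+ k.+1) ->
    {homo (fun k => v k + c * 2^-1 ^+ k) : n m / (n <= m)%N >-> m <= n}.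
  move=> vk; apply/nonincreasing_seqP => k.
  by have := vk k; rewrite ler_norml exprS => /andP[_ ?]; lra.
have ukN k : `|- u k.+1 - - u k| <= c * 2^-1 ^+ k.+1.
  by rewrite -opprD normrN.
have cv (v : nat -> R) : (forall k, `|v k.+1 - v k| <= c * 2^-1 ^+ k.+1) ->
    (forall k, `|- v k.+1 - - v k| <= c * 2^-1 ^+ k.+1) ->
    cvgn (fun k => v k + c * 2^-1 ^+ k).
  move=> vk vkN; apply: nonincreasing_is_cvgn; first exact: key.
  exists (v 0%N - c) => _ [k _ <-] /=.
  have : 0 <= c * 2^-1 ^+ k by rewrite mulr_ge0// exprn_ge0// invr_ge0.
  have /= := key _ vkN 0%N k (leq0n _); rewrite expr0.
  move: (c * 2^-1 ^+ k) => q; lra.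
have cvu : cvgn u.
  have -> : u = (fun k => (u k + c * 2^-1 ^+ k) - c * 2^-1 ^+ k).
    by apply/funext => k; rewrite addrK.
  by apply: is_cvgB; [exact: cv|apply/cvg_ex; exists 0; exact: cvg_half_pow].
have le (v : nat -> R) (l : R) : (forall k, `|v k.+1 - v k| <= c * 2^-1 ^+ k.+1) ->
    v @ \oo --> l -> l <= v K + c * 2^-1 ^+ K.
  move=> vk vl; have h : (fun k => v k + c * 2^-1 ^+ k) @ \oo --> l.
    by rewrite -[l]addr0; apply: cvgD => //; exact: cvg_half_pow.
  rewrite -(cvg_lim _ h)//; apply: (nonincreasing_cvgn_ge (key _ vk)).
  by apply/cvg_ex; exists l.
have /= h1 := le _ _ uk cvu; have h2 : - limn u <= - u K + c * 2^-1 ^+ K.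
  by apply: (le (fun k => - u k) _ ukN); exact: cvgN.
move: h1 h2; rewrite ler_norml; move: (c * _) (limn _) (u K) => x y z h1 h2.
by apply/andP; split; lra.
Qed.


(** * Means over all choices of signs *)

Section signed_mean.
Context {R : realType} {m : nat} {V : lmodType R}.
Implicit Types (w b u : 'rV[R]_m) (ws : seq 'rV[R]_m) (F : 'rV[R]_m -> V).

(* The mean of F over the points [b + \sum_w ± w], all signs being equally likely. *)
Fixpoint signed_mean ws F b : V :=
  if ws is w :: ws' then
    2^-1 *: (signed_mean ws' F (b + w) + signed_mean ws' F (b - w))
  else F b.

Lemma signed_mean_cat ws ws' F b :
  signed_mean (ws ++ ws') F b = signed_mean ws (signed_mean ws' F) b.
Proof. by elim: ws b => //= w ws IH b; rewrite !IH. Qed.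

(** The order of the steps is irrelevant; [layer_central_quotient] brings the step along its own
    direction to the front. *)
Lemma signed_mean_catCons ws w ws' F b :
  signed_mean (ws ++ w :: ws') F b = signed_mean (w :: ws ++ ws') F b.
Proof.
elim: ws b => //= v ws IH b; rewrite !IH /= -!scalerDr.
rewrite (addrAC b w v) (addrAC b w (- v)) (addrAC b (- w) v) (addrAC b (- w) (- v)).
by rewrite addrACA.
Qed.

Lemma eq_signed_mean ws F G b : F =1 G -> signed_mean ws F b = signed_mean ws G b.
Proof. by move=> FG; elim: ws b => //= w ws IH b; rewrite !IH. Qed.

Lemma signed_mean_cst ws (x : V) b : signed_mean ws (fun=> x) b = x.
Proof.
elim: ws b => //= w ws IH b; rewrite !IH -{1 2}[x]scale1r -scalerDl scalerA.
by rewrite (_ : _ * _ = 1) ?scale1r//; field.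
Qed.

Lemma signed_meanB ws F G b :
  signed_mean ws (fun u => F u - G u) b = signed_mean ws F b - signed_mean ws G b.
Proof. by elim: ws b => //= w ws IH b; rewrite !IH -scalerBr opprD addrACA. Qed.

(** Averaging only takes midpoints, so convex sets, balls and intervals are all treated by this one
    induction. The sum is the reach of the steps in coordinate [j]. *)
Lemma signed_mean_midconvex (S : set V) ws F b :
  (forall x y, S x -> S y -> S (2^-1 *: (x + y))) ->
  (forall u, (forall j, `|u 0 j - b 0 j| <= \sum_(w <- ws) `|w 0 j|) -> S (F u)) ->
  S (signed_mean ws F b).
Proof.
move=> mid; elim: ws b => [|w ws IH] b FS /=.
  by apply: FS => j; rewrite subrr normr0 big_nil.
apply: mid; apply: IH => u bu; apply: FS => j; rewrite big_cons.
  have := ler_normD (u 0 j - (b + w) 0 j) (w 0 j); have := bu j.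
  by rewrite !mxE opprD addrA subrK; lra.
have := ler_normB (u 0 j - (b - w) 0 j) (w 0 j); have := bu j.
by rewrite !mxE opprB addrA addrAC addrK addrAC; lra.
Qed.

End signed_mean.

(** * Dyadic approximation of the mean over the cube *)

Section cube_mean.
Context {R : realType} {m : nat}.
Implicit Types (b u : 'rV[R]_m) (F G : 'rV[R]_m -> 'rV[R]_m).

Definition dyadic_layer (k : nat) (s : seq 'I_m) : seq 'rV[R]_m :=
  [seq (2^-1 ^+ k.+1) *: (delta_mx 0 i : 'rV[R]_m) | i <- s].

(** With all choices of signs, the sums of these steps are the centers of the [2^(m K)] subcubes of
    side [2^(1 - K)] of [[-1, 1]^m]. *)
Fixpoint dyadic_steps (K : nat) : seq 'rV[R]_m :=
  if K is k.+1 then dyadic_steps k ++ dyadic_layer k (enum 'I_m) else [::].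

Definition dyadic_mean K F : 'rV[R]_m := signed_mean (dyadic_steps K) F 0.

Definition cube_mean F : 'rV[R]_m :=
  \row_i lim ((fun K => dyadic_mean K F 0 i) @ \oo).

Lemma half_pow_ge0 k : 0 <= 2^-1 ^+ k :> R.
Proof. by rewrite exprn_ge0// invr_ge0. Qed.

Lemma sum_layer k s j : uniq s ->
  \sum_(w <- dyadic_layer k s) `|w 0 j| = if j \in s then 2^-1 ^+ k.+1 else 0 :> R.
Proof.
rewrite /dyadic_layer big_map => us; have [js|js] := boolP (j \in s).
  rewrite (bigD1_seq j)//= big1 ?addr0 => [|i /negPf ij].
    by rewrite !mxE !eqxx mulr1 ger0_norm// half_pow_ge0.
  by rewrite !mxE eq_sym ij andbF mulr0 normr0.
rewrite big_seq big1// => i is'; rewrite !mxE.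
have /negPf -> : j != i by apply: contraNneq js => ->.
by rewrite andbF mulr0 normr0.
Qed.

Lemma sum_steps K j : \sum_(w <- dyadic_steps K) `|w 0 j| = 1 - 2^-1 ^+ K :> R.
Proof.
elim: K => [|K IH] /=; first by rewrite big_nil expr0 subrr.
rewrite big_cat/= IH sum_layer ?enum_uniq// mem_enum inE exprS.
move: (_ ^+ K) => q; lra.
Qed.

Lemma dyadic_mean_midconvex (S : set 'rV[R]_m) K F :
  (forall x y, S x -> S y -> S (2^-1 *: (x + y))) ->
  (forall u, (forall j, `|u 0 j| <= 1) -> S (F u)) -> S (dyadic_mean K F).
Proof.
move=> mid FS; apply: signed_mean_midconvex => // u Hu; apply: FS => j.
have := Hu j; rewrite mxE subr0 sum_steps; have := half_pow_ge0 K.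
move: (_ ^+ K) `|_| => q x; lra.
Qed.

Lemma cube_enorm u : (forall j, `|u 0 j| <= 1) -> enorm u <= Num.sqrt m%:R.
Proof. by move=> u1; rewrite -[leRHS]mulr1; apply: enorm_le_entries. Qed.

Lemma enorm_midconvex (M : R) (x y : 'rV[R]_m) :
  enorm x <= M -> enorm y <= M -> enorm (2^-1 *: (x + y)) <= M.
Proof.
move=> xM yM; rewrite enormZ ger0_norm ?invr_ge0//.
have := enormD x y; lra.
Qed.

Lemma dyadic_mean_bound (M : R) K F :
  (forall u, (forall j, `|u 0 j| <= 1) -> enorm (F u) <= M) ->
  enorm (dyadic_mean K F) <= M.
Proof.
move=> FM; apply: (@dyadic_mean_midconvex [set x | enorm x <= M]) => //.
exact: enorm_midconvex.
Qed.

Lemma dyadic_meanB K F G :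
  dyadic_mean K (fun u => F u - G u) = dyadic_mean K F - dyadic_mean K G.
Proof. exact: signed_meanB. Qed.

Lemma signed_mean_near (L : R) (ws : seq 'rV[R]_m) F b : 0 <= L ->
  (forall u v, enorm (F u - F v) <= L * enorm (u - v)) ->
  enorm (signed_mean ws F b - F b) <= L * \sum_(w <- ws) enorm w.
Proof.
move=> L0 FL; elim: ws b => [|w ws IH] b /=.
  by rewrite subrr enorm0 big_nil mulr0.
rewrite big_cons.
have half c : enorm c = enorm w -> enorm (signed_mean ws F (b + c) - F b) <=
    L * (enorm w + \sum_(j <- ws) enorm j).
  move=> cw; apply: le_trans (enorm_distD (F (b + c)) _ _) _.
  rewrite mulrDr addrC lerD//; apply: le_trans (FL _ _) _.
  by rewrite addrC addKr cw.
have -> : 2^-1 *: (signed_mean ws F (b + w) + signed_mean ws F (b - w)) - F b =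
    2^-1 *: ((signed_mean ws F (b + w) - F b) + (signed_mean ws F (b - w) - F b)).
  by apply/rowP => j; rewrite !mxE; lra.
apply: enorm_midconvex; apply: half => //; exact: enormN.
Qed.

(** Layer [K] replaces each grid point by points at distance at most [m 2^-(K+1)] from it. *)
Lemma dyadic_mean_step (L : R) K F : 0 <= L ->
  (forall u v, enorm (F u - F v) <= L * enorm (u - v)) ->
  enorm (dyadic_mean K.+1 F - dyadic_mean K F) <= m%:R * L * 2^-1 ^+ K.+1.
Proof.
move=> L0 FL; rewrite /dyadic_mean /= signed_mean_cat -signed_meanB.
apply: (@dyadic_mean_bound _ K) => u _.
apply: le_trans (signed_mean_near _ _ L0 FL) _.
rewrite /dyadic_layer big_map (eq_bigr (fun=> 2^-1 ^+ K.+1)); last first.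
  move=> i _; rewrite enormZ ger0_norm ?half_pow_ge0//.
  by rewrite enorm_delta mulr1.
by rewrite big_enum/= sumr_const card_ord -[X in _ * X]mulr_natl mulrCA mulrA.
Qed.

Lemma dyadic_mean_cvg (L : R) K F : 0 <= L ->
  (forall u v, enorm (F u - F v) <= L * enorm (u - v)) ->
  enorm (dyadic_mean K F - cube_mean F) <=
    Num.sqrt m%:R * (m%:R * L) * 2^-1 ^+ K.
Proof.
move=> L0 FL; rewrite -mulrA; apply: enorm_le_entries => [|i].
  by rewrite !mulr_ge0// half_pow_ge0.
rewrite !mxE; apply: (@half_pow_cauchy _ (fun K => dyadic_mean K F 0 i)) => [|k].
  by rewrite mulr_ge0.
apply: le_trans (dyadic_mean_step k L0 FL).
by have := enorm_entry (dyadic_mean k.+1 F - dyadic_mean k F) i; rewrite !mxE.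
Qed.

Lemma dyadic_mean_cst K (x : 'rV[R]_m) : dyadic_mean K (fun=> x) = x.
Proof. exact: signed_mean_cst. Qed.

(** Estimates on cube means are proved on the grids and pass to the limit here; [c * 2^-1 ^+ K] is
    room for a discretization error. *)
Lemma cube_meanB_le (L M c : R) F G : 0 <= L ->
  (forall u v, enorm (F u - F v) <= L * enorm (u - v)) ->
  (forall u v, enorm (G u - G v) <= L * enorm (u - v)) ->
  (forall K, enorm (dyadic_mean K F - dyadic_mean K G) <= M + c * 2^-1 ^+ K) ->
  enorm (cube_mean F - cube_mean G) <= M.
Proof.
move=> L0 FL GL FG; pose d := Num.sqrt m%:R * (m%:R * L).
apply: (le_half_pow (c := c + 2 * d)) => K.
apply: le_trans (enorm_distD (dyadic_mean K F) _ _) _.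
have := enorm_distD (dyadic_mean K G) (dyadic_mean K F) (cube_mean G).
have := dyadic_mean_cvg K L0 FL; have := dyadic_mean_cvg K L0 GL; have := FG K.
rewrite (enormB (cube_mean F)) -/d mulrDl.
move: (enorm _) (enorm _) (enorm _) (enorm _) (_ ^+ K) => x y z t q; lra.
Qed.

(** The grid means lie in [C] by midpoint convexity; their limit is at distance zero from [C], so it
    is its own projection. *)
Lemma cube_mean_in (C : set 'rV[R]_m) (L : R) F : closed_convex C -> 0 <= L ->
  (forall u v, enorm (F u - F v) <= L * enorm (u - v)) ->
  (forall u, C (F u)) -> C (cube_mean F).
Proof.
move=> hC L0 FL FC; have CK K : C (dyadic_mean K F).
  apply: dyadic_mean_midconvex => // x y Cx Cy; case: (hC) => _ _ /(_ x y 2^-1 Cx Cy).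
  have -> : 1 - 2^-1 = 2^-1 :> R by field.
  by rewrite -scalerDr; apply; rewrite invr_ge0 invf_le1//= ler0n ler1n.
suff d0 : dist C (cube_mean F) = 0 by rewrite -(dist_eq0 d0); exact: proj_in.
apply/eqP; rewrite eq_le dist_ge0 andbT.
apply: (le_half_pow (c := Num.sqrt m%:R * (m%:R * L))) => K; rewrite add0r.
by apply: le_trans (dist_le hC _ (CK K)) _; rewrite enormB dyadic_mean_cvg.
Qed.

End cube_mean.

Lemma half_diff_le {R : realType} (x y M : R) :
  `|x| <= M -> `|y| <= M -> `|(x - y) / 2| <= M.
Proof.
rewrite normrM [`|2^-1|]ger0_norm ?invr_ge0// => xM yM.
by have := ler_normB x y; lra.
Qed.

Lemma half_sum_le {R : realType} (x y M : R) :
  `|x| <= M -> `|y| <= M -> `|2^-1 * (x + y)| <= M.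
Proof. by move=> xM yM; rewrite mulrC -[y]opprK half_diff_le// normrN. Qed.

(** * Reduction to two opposite faces of the cube *)

Section telescoping.
Context {R : realType} {m : nat}.
Implicit Types (b u : 'rV[R]_m) (F : 'rV[R]_m -> 'rV[R]_m) (f : 'rV[R]_m -> R^o).

Definition central_quotient (h : R) (i : 'I_m) f b : R^o :=
  (f (b + h *: delta_mx 0 i) - f (b - h *: delta_mx 0 i)) / (2 * h).

Lemma signed_mean_entry ws F b i :
  signed_mean ws F b 0 i = signed_mean ws (fun u => F u 0 i : R^o) b.
Proof. by elim: ws b => //= w ws IH b; rewrite -!IH !mxE. Qed.

Lemma signed_mean_central_quotient ws h i f b :
  signed_mean ws (central_quotient h i f) b =
  central_quotient h i (signed_mean ws f) b.
Proof.
rewrite /central_quotient; move: (h *: _) => d.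
elim: ws b => //= w ws IH b; rewrite !IH.
rewrite (addrAC b d w) (addrAC b d (- w)) (addrAC b (- d) w) (addrAC b (- d) (- w)).
rewrite /GRing.scale/=; ring.
Qed.

(** Averaging the quotient over the two shifts [± 2^-(k+1) e_i] cancels the middle values and leaves
    the quotient of twice the step; the other directions of the layer commute with it. *)
Lemma layer_central_quotient k s1 i s2 f b :
  signed_mean (dyadic_layer k (s1 ++ i :: s2)) (central_quotient (2^-1 ^+ k.+1) i f) b =
  central_quotient (2^-1 ^+ k) i (signed_mean (dyadic_layer k (s1 ++ s2)) f) b.
Proof.
rewrite /dyadic_layer map_cat /= signed_mean_catCons -map_cat /=.
rewrite !signed_mean_central_quotient.
rewrite /central_quotient; set q := signed_mean _ f.
have k0 : 2^-1 ^+ k != 0 :> R by rewrite expf_neq0// invr_eq0 pnatr_eq0.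
have -> : 2^-1 ^+ k *: delta_mx 0 i =
    2^-1 ^+ k.+1 *: delta_mx 0 i + 2^-1 ^+ k.+1 *: delta_mx 0 i :> 'rV[R]_m.
  by rewrite -scalerDl exprS -mulrDl (_ : 2^-1 + 2^-1 = 1 :> R) ?mul1r//; field.
rewrite exprS; move: (_ *: delta_mx 0 i) => d.
rewrite addrK subrK opprD !addrA /GRing.scale/=; field; exact: k0.
Qed.

(* The central quotients of step [2^-K] telescope along direction [i], so that
   only values of [f] on two opposite faces of the cube remain. *)
Lemma steps_central_quotient_le K i (M : R) f b :
  (forall u, `|u 0 i - b 0 i| <= 1 ->
     (forall j, j != i -> `|u 0 j - b 0 j| <= 1 - 2^-1 ^+ K) -> `|f u| <= M) ->
  `|signed_mean (dyadic_steps K) (central_quotient (2^-1 ^+ K) i f) b| <= M.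
Proof.
elim: K f => [|K IH] f fM.
  rewrite /= /central_quotient expr0 !scale1r mulr1.
  have h (x : 'rV[R]_m) : (forall j, j != i -> x 0 j = 0) -> `|x 0 i| <= 1 -> `|f (b + x)| <= M.
    move=> xj xi; apply: fM => [|j ji]; rewrite !mxE addrAC subrr add0r//.
    by rewrite xj// normr0 expr0 subrr.
  have := h (delta_mx 0 i); have := h (- delta_mx 0 i).
  rewrite !mxE !eqxx normrN normr1 lexx => /(_ _ isT) h1 /(_ _ isT) h2.
  have {}h1 : `|f (b - delta_mx 0 i)| <= M.
    by apply: h1 => j /negPf ji; rewrite !mxE ji andbF oppr0.
  have {}h2 : `|f (b + delta_mx 0 i)| <= M.
    by apply: h2 => j /negPf ji; rewrite !mxE ji andbF.
  exact: half_diff_le.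
rewrite /= signed_mean_cat.
have [s1 [s2 Es]] : exists s1 s2, enum 'I_m = s1 ++ i :: s2.
  have : i \in enum 'I_m by rewrite mem_enum.
  by case/splitPr => s1 s2; exists s1, s2.
have : uniq (enum 'I_m) := enum_uniq _; rewrite Es => us.
have [us12 i12] : uniq (s1 ++ s2) /\ i \notin s1 ++ s2.
  by move: us; rewrite uniq_catC /= uniq_catC mem_cat orbC -mem_cat => /andP[].
(* The last layer doubles the step along [i]; its other directions are averaged into [f]. They move
   a coordinate [j != i] by at most [2^-(K+1)], which is the growth of the range [1 - 2^-K] from [K]
   to [K + 1]. *)
rewrite (eq_signed_mean _ _ (layer_central_quotient K s1 i s2 f)).
apply: IH => u ui uj.
apply: (@signed_mean_midconvex _ _ _ [set x : R^o | `|x| <= M]) => [x y /= xM yM|v vu].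
  exact: half_sum_le.
have {}vu j : `|v 0 j - u 0 j| <= if j \in s1 ++ s2 then 2^-1 ^+ K.+1 else 0.
  by rewrite -(sum_layer K _ us12).
apply: fM => [|j ji].
  have := vu i; rewrite (negPf i12) normr_le0 subr_eq0 => /eqP ->; exact: ui.
have {}vu : `|v 0 j - u 0 j| <= 2^-1 ^+ K.+1.
  by apply: le_trans (vu j) _; case: ifP => // _; exact: half_pow_ge0.
have := ler_normD (v 0 j - u 0 j) (u 0 j - b 0 j); rewrite addrA subrK.
move: vu (uj j ji); rewrite exprS.
move: (2^-1 ^+ K) `|_| `|_| `|_| => q x y z; lra.
Qed.

End telescoping.

(** * The selection map *)

Section selection.
Context {R : realType} {m : nat}.
Hypothesis m_gt0 : (0 < m)%N.
Implicit Types (C D : set 'rV[R]_m) (a b u : 'rV[R]_m) (r s h : R).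

Let rtm : R := Num.sqrt m%:R.

Definition mean_proj C a r : 'rV[R]_m := cube_mean (fun u => proj C (a + r *: u)).

Definition selection C a : 'rV[R]_m := mean_proj C a (dist C a / Num.sqrt m%:R).

Let rtm_gt0 : 0 < rtm. Proof. by rewrite sqrtr_gt0 ltr0n. Qed.

Lemma proj_affine_lip C a r u v : closed_convex C ->
  enorm (proj C (a + r *: u) - proj C (a + r *: v)) <= `|r| * enorm (u - v).
Proof.
move=> hC; apply: le_trans (proj_lip hC _ _) _.
by rewrite opprD addrACA subrr add0r -scalerBr enormZ.
Qed.

Lemma selection_in C a : closed_convex C -> C (selection C a).
Proof.
move=> hC; apply: (cube_mean_in hC (normr_ge0 (dist C a / Num.sqrt m%:R))) => u.
  by move=> v; exact: proj_affine_lip.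
exact: proj_in.
Qed.

Lemma selection_id C a : closed_convex C -> C a -> selection C a = a.
Proof.
move=> hC Ca; rewrite /selection /mean_proj dist_in// mul0r.
have Pa : proj C a = a by apply: dist_eq0; exact: dist_in.
have -> : (fun u => proj C (a + 0 *: u)) = (fun=> a).
  by apply/funext => u; rewrite scale0r addr0.
apply/rowP => i; rewrite mxE; under eq_fun do rewrite dyadic_mean_cst.
exact: lim_cst.
Qed.

(** On the cube, [proj C] stays within [dist C a] of [proj C a], itself at distance [dist C a] from
    [a]. *)
Lemma selection_dist C a : closed_convex C ->
  enorm (selection C a - a) <= 2 * dist C a.
Proof.
move=> hC; rewrite /selection; set r := dist C a / _.
have r0 : 0 <= r by rewrite divr_ge0 ?dist_ge0// ltW.
have aE : a = cube_mean (fun=> a).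
  by apply/rowP => i; rewrite mxE; under eq_fun do rewrite dyadic_mean_cst; rewrite lim_cst.
rewrite [X in _ - X]aE; apply: (@cube_meanB_le _ _ r _ 0) => //.
- by move=> u v; apply: le_trans (proj_affine_lip _ _ _ _ hC) _; rewrite ger0_norm.
- by move=> u v; rewrite subrr enorm0 mulr_ge0// enorm_ge0.
move=> K; rewrite mul0r addr0 -dyadic_meanB; apply: dyadic_mean_bound => u /cube_enorm u1.
apply: le_trans (enorm_distD (proj C a) _ _) _.
rewrite mulr_natl mulr2n lerD//; last by rewrite enormB.
apply: le_trans (proj_lip hC _ _) _; rewrite addrC addKr enormZ ger0_norm//.
by rewrite -[leRHS](divfK (lt0r_neq0 rtm_gt0)) ler_wpM2l.
Qed.

Lemma mean_proj_lip C a b r s : closed_convex C ->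
  enorm (mean_proj C a r - mean_proj C b s) <= enorm (a - b) + `|r - s| * rtm.
Proof.
move=> hC; apply: (@cube_meanB_le _ _ (`|r| + `|s|) _ 0).
- by rewrite addr_ge0.
- move=> u v; apply: le_trans (proj_affine_lip _ _ _ _ hC) _.
  by rewrite ler_wpM2r ?enorm_ge0// lerDl.
- move=> u v; apply: le_trans (proj_affine_lip _ _ _ _ hC) _.
  by rewrite ler_wpM2r ?enorm_ge0// lerDr.
move=> K; rewrite mul0r addr0 -dyadic_meanB; apply: dyadic_mean_bound => u /cube_enorm u1.
apply: le_trans (proj_lip hC _ _) _; rewrite opprD addrACA -scalerBl.
by apply: le_trans (enormD _ _) _; rewrite lerD2l enormZ ler_wpM2l.
Qed.

(** One [enorm (a - b)] comes from moving the center, the other from changing the half-side, since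
    [rtm * |r - s| = |dist C a - dist C b|]. *)
Lemma selection_lip C a b : closed_convex C ->
  enorm (selection C a - selection C b) <= 2 * enorm (a - b).
Proof.
move=> hC; apply: le_trans (mean_proj_lip _ _ _ _ hC) _.
rewrite -mulrBl normrM [`|_^-1|]gtr0_norm ?invr_gt0// divfK ?lt0r_neq0//.
by have := dist_lip hC a b; lra.
Qed.

(** The difference of the projections is the gradient of [(dist D ^+ 2 - dist C ^+ 2) / 2]; the
    substitution [b = a + r *: u] divides it by [r]. Each of the two residuals brings an error
    [r * h]. *)
Lemma mean_proj_quotient C D a r i u h : closed_convex C -> closed_convex D ->
  0 < r -> 0 < h ->
  `|(proj C (a + r *: u) - proj D (a + r *: u)) 0 i -
    central_quotient h i (fun u =>
      (dist D (a + r *: u) ^+ 2 - dist C (a + r *: u) ^+ 2) / (2 * r)) u| <= 2 * (r * h).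
Proof.
move=> hC hD r0 h0; rewrite /central_quotient.
rewrite !(scalerBr r) !(scalerDr r) !scalerA !addrA.
move: (a + r *: u) => b; set s := r * h.
have s0 : 0 < s by rewrite mulr_gt0.
have := residual_diff_quotient hC b i s0; have := residual_diff_quotient hD b i s0.
move: (dist D _) (dist D _) (dist C _) (dist C _) => d2 d1 d4 d3.
have -> : ((d1 ^+ 2 - d3 ^+ 2) / (2 * r) - (d2 ^+ 2 - d4 ^+ 2) / (2 * r)) / (2 * h) =
    (d1 ^+ 2 - d2 ^+ 2) / (4 * s) - (d3 ^+ 2 - d4 ^+ 2) / (4 * s).
  by rewrite /s; field; rewrite !gt_eqF.
rewrite !mxE; move: (_ / _) (_ / _) => p q.
move: (b 0 i) (proj C b 0 i) (proj D b 0 i) => x y z.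
clear -s0; rewrite !ler_norml => /andP[? ?] /andP[? ?].
by apply/andP; split; lra.
Qed.

(** Within [r * rtm] of [a] both distances are at most [2 r rtm], so their squares differ by at most
    [4 r rtm eta]. Dividing by [2 r] bounds each entry by [2 rtm eta], and the Euclidean norm costs
    another [rtm]. *)
Lemma mean_proj_stable C D a r (eta : R) : closed_convex C -> closed_convex D ->
  0 < r -> dist C a <= r * rtm -> dist D a <= r * rtm ->
  (forall b, enorm (b - a) <= r * rtm -> `|dist C b - dist D b| <= eta) ->
  enorm (mean_proj C a r - mean_proj D a r) <= 2 * m%:R * eta.
Proof.
move=> hC hD r0 Ca Da near_a.
apply: (@cube_meanB_le _ _ r _ (rtm * (2 * r))); first exact: ltW.
- by move=> u v; apply: le_trans (proj_affine_lip _ _ _ _ hC) _; rewrite gtr0_norm.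
- by move=> u v; apply: le_trans (proj_affine_lip _ _ _ _ hD) _; rewrite gtr0_norm.
have eta0 : 0 <= eta.
  by apply: le_trans (near_a a _); rewrite ?normr_ge0// subrr enorm0 mulr_ge0 ?ltW.
move=> K; have K0 : 0 < 2^-1 ^+ K :> R by rewrite exprn_gt0// invr_gt0.
have -> : 2 * m%:R * eta + rtm * (2 * r) * 2^-1 ^+ K =
    rtm * (2 * rtm * eta + 2 * (r * 2^-1 ^+ K)).
  have <- : rtm ^+ 2 = m%:R by rewrite sqr_sqrtr// ler0n.
  by ring.
apply: enorm_le_entries => [|i].
  by rewrite addr_ge0 ?mulr_ge0// ltW.
rewrite -dyadic_meanB /dyadic_mean signed_mean_entry.
set f := fun u => (dist D (a + r *: u) ^+ 2 - dist C (a + r *: u) ^+ 2) / (2 * r).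
rewrite -[signed_mean _ _ _](subrK
  (signed_mean (dyadic_steps K) (central_quotient (2^-1 ^+ K) i f) 0)).
apply: le_trans (ler_normD _ _) _; rewrite addrC lerD//.
  apply: steps_central_quotient_le => u ui uj.
  have {ui uj} u1 : enorm u <= rtm.
    apply: cube_enorm => j; have [->|ji] := eqVneq j i.
      by move: ui; rewrite mxE subr0.
    have := uj j ji; rewrite mxE subr0 => /le_trans; apply.
    by rewrite gerBl ltW.
  have ru : enorm (a + r *: u - a) <= r * rtm.
    by rewrite addrC addKr enormZ gtr0_norm// ler_wpM2l// ltW.
  rewrite /f; move: (a + r *: u) ru => b ba.
  have := near_a b ba; have := dist_lip hC b a; have := dist_lip hD b a.
  have := dist_ge0 C b; have := dist_ge0 D b.
  move: ba Ca Da; move: (enorm _) => e.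
  move: (dist C b) (dist D b) (dist C a) (dist D a) => x y z t.
  clear -r0 eta0 rtm_gt0 => er zr tr y0 x0 yt xz xy.
  rewrite subr_sqr normrM normrM normfV [`|2 * r|]gtr0_norm ?mulr_gt0//.
  rewrite ler_pdivrMr ?mulr_gt0// distrC.
  have -> : 2 * rtm * eta * (2 * r) = eta * (4 * (r * rtm)) by ring.
  rewrite ler_pM// ger0_norm ?addr_ge0//.
  move: yt xz; rewrite !ler_norml => /andP[_ ?] /andP[_ ?]; lra.
rewrite -signed_meanB.
apply: (@signed_mean_midconvex _ _ _ [set x : R^o | `|x| <= 2 * (r * 2^-1 ^+ K)]).
  by move=> x y /= xM yM; exact: half_sum_le.
by move=> u _; exact: mean_proj_quotient.
Qed.

(** With the half-side fixed by the larger distance, changing the set costs [2 m eta]; adjusting the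
    half-side costs one more [eta]. If the larger distance is zero, [a] lies in both sets. *)
Lemma selection_stable C D a (eta : R) : closed_convex C -> closed_convex D ->
  (forall b, enorm (b - a) <= Num.max (dist C a) (dist D a) ->
     `|dist C b - dist D b| <= eta) ->
  enorm (selection C a - selection D a) <= (2 * m%:R + 1) * eta.
Proof.
wlog CD : C D / dist D a <= dist C a.
  move=> wl hC hD near_a; have [|/ltW] := leP (dist D a) (dist C a); first by move/wl; apply.
  move=> CD; rewrite enormB; apply: wl => // b; rewrite maxC distrC; exact: near_a.
move=> hC hD; rewrite (max_l CD) => near_a.
have [C0|C0] := eqVneq (dist C a) 0.
  have D0 : dist D a = 0 by apply/eqP; rewrite eq_le dist_ge0 andbT -C0.
  have aC : C a by rewrite -(dist_eq0 C0); exact: proj_in.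
  have aD : D a by rewrite -(dist_eq0 D0); exact: proj_in.
  rewrite !selection_id// subrr enorm0 mulr_ge0// ?addr_ge0//.
  by apply: le_trans (near_a a _); rewrite ?normr_ge0// subrr enorm0 dist_ge0.
rewrite {1}/selection; set r := dist C a / _.
have rE : r * rtm = dist C a by rewrite divfK// lt0r_neq0.
have r0 : 0 < r by rewrite divr_gt0// lt0r C0 dist_ge0.
apply: le_trans (enorm_distD (mean_proj D a r) _ _) _; rewrite mulrDl mul1r lerD//.
  by apply: mean_proj_stable => //; rewrite rE.
apply: le_trans (mean_proj_lip _ _ _ _ hD) _; rewrite subrr enorm0 add0r.
rewrite -mulrBl normrM [`|_^-1|]gtr0_norm ?invr_gt0// divfK ?lt0r_neq0//.
by apply: near_a; rewrite subrr enorm0 dist_ge0.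
Qed.

End selection.

(** * Epigraphs of conjugate functions *)

Section pair.
Context {R : realType} {n : nat}.
Implicit Types (p q : 'rV[R]_n) (a b : 'rV[R]_(n + 1)) (s : R).

Definition pair_rV p s : 'rV[R]_(n + 1) := row_mx p (\row_(j < 1) s).

Definition last_coord a : R := rsubmx a 0 0.

Lemma lsubmx_pair p s : lsubmx (pair_rV p s) = p.
Proof. by rewrite row_mxKl. Qed.

Lemma last_coord_pair p s : last_coord (pair_rV p s) = s.
Proof. by rewrite /last_coord row_mxKr mxE. Qed.

Lemma pair_rVE a : a = pair_rV (lsubmx a) (last_coord a).
Proof.
rewrite -{1}[a]hsubmxK; congr row_mx.
by apply/rowP => j; rewrite (ord1 j) mxE.
Qed.

Lemma lsubmxD a b : lsubmx (a + b) = lsubmx a + lsubmx b.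
Proof. by apply/rowP => j; rewrite !mxE. Qed.

Lemma lsubmxB a b : lsubmx (a - b) = lsubmx a - lsubmx b.
Proof. by apply/rowP => j; rewrite !mxE. Qed.

Lemma lsubmxZ s a : lsubmx (s *: a) = s *: lsubmx a.
Proof. by apply/rowP => j; rewrite !mxE. Qed.

Lemma last_coordD a b : last_coord (a + b) = last_coord a + last_coord b.
Proof. by rewrite /last_coord !mxE. Qed.

Lemma last_coordB a b : last_coord (a - b) = last_coord a - last_coord b.
Proof. by rewrite /last_coord !mxE. Qed.

Lemma last_coordZ s a : last_coord (s *: a) = s * last_coord a.
Proof. by rewrite /last_coord !mxE. Qed.

Lemma pair_rVB p q s t : pair_rV p s - pair_rV q t = pair_rV (p - q) (s - t).
Proof.
by rewrite [LHS]pair_rVE lsubmxB last_coordB !lsubmx_pair !last_coord_pair.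
Qed.

Lemma pair_rVZ p s t : t *: pair_rV p s = pair_rV (t *: p) (t * s).
Proof.
by rewrite [LHS]pair_rVE lsubmxZ last_coordZ !lsubmx_pair !last_coord_pair.
Qed.

Lemma pair_rV_shift a s :
  pair_rV (lsubmx a) (last_coord a + s) = a + pair_rV 0 s.
Proof.
by rewrite [RHS]pair_rVE lsubmxD last_coordD lsubmx_pair last_coord_pair addr0.
Qed.

Lemma dotv_pair a b :
  dotv a b = dotv (lsubmx a) (lsubmx b) + last_coord a * last_coord b.
Proof.
rewrite !dotvE big_split_ord/= big_ord1; congr (_ + _).
  by apply: eq_bigr => i _; rewrite !mxE.
by rewrite /last_coord !mxE.
Qed.

Lemma sqr_enorm_pair a : enorm a ^+ 2 = enorm (lsubmx a) ^+ 2 + last_coord a ^+ 2.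
Proof. by rewrite !sqr_enorm dotv_pair -expr2. Qed.

Lemma enorm_lsubmx a : enorm (lsubmx a) <= enorm a.
Proof.
rewrite -(@ler_pXn2r _ 2)// ?nnegrE ?enorm_ge0// sqr_enorm_pair.
by rewrite lerDl sqr_ge0.
Qed.

Lemma normr_last_coord a : `|last_coord a| <= enorm a.
Proof.
rewrite -(@ler_pXn2r _ 2)// ?nnegrE ?enorm_ge0 ?normr_ge0// sqr_enorm_pair.
by rewrite real_normK ?num_real// lerDr sqr_ge0.
Qed.

Lemma enorm_pair_le a : enorm a <= enorm (lsubmx a) + `|last_coord a|.
Proof.
rewrite -(@ler_pXn2r _ 2)// ?nnegrE ?addr_ge0 ?enorm_ge0 ?normr_ge0//.
rewrite sqr_enorm_pair sqrrD real_normK ?num_real// addrAC lerDl.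
by rewrite mulrn_wge0// mulr_ge0 ?enorm_ge0.
Qed.

End pair.

Lemma continuous_enorm_lip {R : realType} {m : nat} (f : 'rV[R]_m -> R) (L : R) :
  (forall u v, `|f u - f v| <= L * enorm (u - v)) -> continuous f.
Proof.
move=> fL u; apply/(@cvgrPdist_lt _ _ _ _ (nbhs_filter u)) => e e0.
have L0 : 0 < `|L| + 1 by rewrite ltr_wpDl.
apply: filterS (near_enorm u (divr_gt0 e0 L0)) => v.
rewrite ltr_pdivlMr// mulrC; apply: le_lt_trans; apply: le_trans (fL u v) _.
by rewrite ler_wpM2r ?enorm_ge0// (le_trans (ler_norm L))// lerDl.
Qed.

(** * Distance to the epigraph of a conjugate *)

Section conjugate_epigraph.
Context {R : realType} {n : nat}.
Implicit Types (h : 'rV[R]_n -> R) (p q v : 'rV[R]_n) (a b z : 'rV[R]_(n + 1)) (s c : R).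

(** The epigraph of the conjugate of [h], written without extended reals as an intersection of
    half-spaces. *)
Definition conj_epi h : set 'rV[R]_(n + 1) :=
  [set a | forall p, dotv (lsubmx a) p - h p <= last_coord a].

Definition convex_lip c h :=
  convex_fun_rV h /\ forall p q, `|h p - h q| <= c * enorm (p - q).

Lemma convex_epigraph c h : convex_lip c h -> 0 <= c ->
  closed_convex [set a : 'rV[R]_(n + 1) | h (lsubmx a) <= last_coord a].
Proof.
move=> [hconv hlip] c0; split.
- by exists (pair_rV 0 (h 0)); rewrite /= lsubmx_pair last_coord_pair.
- have -> : [set a : 'rV[R]_(n + 1) | h (lsubmx a) <= last_coord a] =
      (fun a : 'rV[R]_(n + 1) => h (lsubmx a) - last_coord a) @^-1` [set s | s <= 0].
    by apply/seteqP; split => a /=; rewrite subr_le0.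
  apply: closed_comp; last exact: closed_le.
  move=> a _; apply: (@continuous_enorm_lip _ _ _ (c + 1)) => u v.
  rewrite opprD opprK addrACA (addrC (- last_coord u)).
  apply: le_trans (ler_normD _ _) _; rewrite mulrDl mul1r lerD//.
    apply: le_trans (hlip _ _) _; rewrite ler_wpM2l// -lsubmxB; exact: enorm_lsubmx.
  by rewrite distrC -last_coordB; exact: normr_last_coord.
- move=> x y s /= hx hy /[dup] s01 /andP[s0 s1].
  rewrite lsubmxD last_coordD !lsubmxZ !last_coordZ.
  apply: le_trans (hconv _ _ _ s01) _; rewrite lerD// ler_wpM2l// subr_ge0//.
Qed.

(* Fenchel-Moreau, by projecting [(p, s)] onto the epigraph of [h]. *)
Lemma conj_epi_above c h p s : convex_lip c h -> 0 <= c -> s < h p ->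
  exists a, conj_epi h a /\ s < dotv (lsubmx a) p - last_coord a.
Proof.
move=> hh c0 sp; set G := [set a : 'rV[R]_(n + 1) | h (lsubmx a) <= last_coord a].
have hG : closed_convex G := convex_epigraph hh c0.
have := proj_in hG (pair_rV p s); have := proj_dot hG (pair_rV p s).
rewrite [proj G _]pair_rVE; move: (lsubmx _) (last_coord _) => q t.
rewrite pair_rVB => dotG; rewrite /G /= lsubmx_pair last_coord_pair => qt.
have {}dotG q' t' : h q' <= t' -> dotv (p - q) (q' - q) + (s - t) * (t' - t) <= 0.
  move=> hq'; have := dotG (pair_rV q' t').
  rewrite pair_rVB dotv_pair !lsubmx_pair !last_coord_pair; apply.
  by rewrite /G /= lsubmx_pair last_coord_pair.
have st : s <= t.
  have := dotG q (t + 1); rewrite subrr dotv0 add0r (addrC t) addrK mulr1 subr_le0.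
  by apply; lra.
(* The normal [(p - q, s - t)] is not horizontal: testing it against [(p, h p)] would give
   [p = q]. *)
have {}st : s < t.
  rewrite lt_neqAle st andbT; apply/eqP => ste.
  have := dotG p (h p) (lexx _); rewrite ste subrr mul0r addr0 -sqr_enorm => pq.
  have : p = q.
    apply/eqP; rewrite -subr_eq0; apply/eqP/enorm_eq0/eqP.
    by rewrite -sqrf_eq0 eq_le pq sqr_ge0.
  by move=> pqE; move: sp; rewrite ste pqE ltNge qt.
have ts : 0 < t - s by rewrite subr_gt0.
(* The supporting hyperplane at [(q, t)] as an affine minorant of [h]; its value at [p] is at least
   [t], hence above [s]. *)
exists (pair_rV ((t - s)^-1 *: (p - q)) ((t - s)^-1 * dotv (p - q) q - t)).
rewrite /conj_epi /= lsubmx_pair last_coord_pair; split => [q'|].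
  have := dotG q' (h q') (lexx _); rewrite dotvZl dotvBr.
  move: (dotv _ q') (dotv _ q) (h q') => d1 d2 y hd.
  by rewrite -(ler_pM2l ts) !mulrBr !mulVKf ?gt_eqF//; lra.
have : 0 <= (t - s)^-1 * dotv (p - q) (p - q).
  by rewrite mulr_ge0 ?dotv_ge0// invr_ge0 ltW.
rewrite dotvZl (dotvBr (p - q)) mulrBr.
by move: (_ * dotv _ p) (_ * dotv _ q) => d1 d2; lra.
Qed.

Lemma conj_epi_closed_convex c h : convex_lip c h -> 0 <= c -> closed_convex (conj_epi h).
Proof.
move=> hh c0; split.
- have [a [Ea _]] : exists a, conj_epi h a /\ h 0 - 1 < dotv (lsubmx a) 0 - last_coord a.
    by apply: (conj_epi_above hh c0); lra.
  by exists a.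
- have -> : conj_epi h = \bigcap_p (dotv (pair_rV p (-1)) @^-1` [set s | s <= h p]).
    apply/seteqP; split => a /= Ea p; have := Ea p.
      move=> Ep _ /=; rewrite dotv_pair lsubmx_pair last_coord_pair dotvC; lra.
    move=> /(_ I) /=; rewrite dotv_pair lsubmx_pair last_coord_pair dotvC; lra.
  apply: closed_bigI => p _; apply: closed_comp; last exact: closed_le.
  by move=> a _; exact: continuous_dotv.
- move=> x y s Ex Ey /andP[s0 s1] p.
  rewrite lsubmxD last_coordD !lsubmxZ !last_coordZ dotvDl !dotvZl.
  have s1' : 0 <= 1 - s by lra.
  have := ler_wpM2l s1' (Ex p); have := ler_wpM2l s0 (Ey p).
  rewrite !mulrBr; lra.
Qed.

Lemma conj_epi_last_ge h a : conj_epi h a -> - h 0 <= last_coord a.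
Proof. by move=> /(_ 0); rewrite dotv0 add0r. Qed.

(** With [v = lsubmx a], [<v, t v> - h (t v)] is at least [t |v| (|v| - c) - h 0], which is
    unbounded in [t] if [|v| > c]. *)
Lemma conj_epi_slope_le c h a : convex_lip c h -> 0 <= c -> conj_epi h a ->
  enorm (lsubmx a) <= c.
Proof.
move=> [_ hlip] c0 Ea; rewrite leNgt; apply/negP => cv.
have := Ea; have := conj_epi_last_ge Ea; rewrite /conj_epi /=.
move: (lsubmx a) (last_coord a) cv => v r cv hr Ev.
have v0 : 0 < enorm v := le_lt_trans c0 cv.
pose D := enorm v * (enorm v - c); have D0 : 0 < D by rewrite mulr_gt0// subr_gt0.
pose t := (h 0 + r + 1) / D.
have t0 : 0 < t by rewrite divr_gt0//; lra.
have tD : t * D = h 0 + r + 1 by rewrite divfK// gt_eqF.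
have := Ev (t *: v); have := hlip (t *: v) 0.
rewrite subr0 enormZ (gtr0_norm t0) dotvZr -sqr_enorm ler_norml => /andP[_ h1] h2.
by move: tD; rewrite /D; lra.
Qed.

(* [h p = sup <v, p> - r] over the epigraph, in the perspective form
   [mu h (p / mu)]; the error term accounts for moving the last coordinate
   of the normal vector from [-lam] to [-mu]. *)
Lemma perspective_le c h p (lam mu M : R) : convex_lip c h -> 0 <= c ->
  0 < mu -> lam <= mu ->
  (forall a, conj_epi h a -> dotv (lsubmx a) p - lam * last_coord a <= M) ->
  mu * h (mu^-1 *: p) <= M + (mu - lam) * h 0.
Proof.
move=> hh c0 mu0 lmu EM; rewrite leNgt; apply/negP => lt.
have : mu^-1 * (M + (mu - lam) * h 0) < h (mu^-1 *: p).
  by rewrite -(ltr_pM2l mu0) mulVKf ?gt_eqF.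
move=> /(conj_epi_above hh c0)[a [Ea]].
rewrite dotvZr -(ltr_pM2l mu0) mulrBr !mulVKf ?gt_eqF// => lta.
have := EM a Ea; have := conj_epi_last_ge Ea.
have l0 : 0 <= mu - lam by lra.
move=> /(ler_wpM2l l0); move: lta; rewrite mulrBl mulrN mulrDl; lra.
Qed.

Lemma conj_epi_up h a s : 0 <= s -> conj_epi h a -> conj_epi h (a + pair_rV 0 s).
Proof.
move=> s0 Ea p; have := Ea p.
by rewrite lsubmxD last_coordD lsubmx_pair last_coord_pair addr0; lra.
Qed.

(** The epigraph is closed under moving up, so an outward normal cannot point upward. *)
Lemma residual_last_le0 c h b : convex_lip c h -> 0 <= c ->
  last_coord (b - proj (conj_epi h) b) <= 0.
Proof.
move=> hh c0; have hE := conj_epi_closed_convex hh c0.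
have := proj_dot hE b (conj_epi_up (ler01) (proj_in hE b)).
by rewrite (addrC _ (pair_rV 0 1)) addrK dotv_pair lsubmx_pair last_coord_pair dotv0 add0r mulr1.
Qed.

(** The residual [w] is an outward normal at the projection, which bounds [<w, a>] on the epigraph.
    Its last coordinate may vanish, hence the larger [mu]. *)
Lemma residual_perspective_le c h b mu (w := b - proj (conj_epi h) b) :
  convex_lip c h -> 0 <= c -> - last_coord w < mu ->
  mu * h (mu^-1 *: lsubmx w) <=
  dotv w (proj (conj_epi h) b) + (mu + last_coord w) * h 0.
Proof.
move=> hh c0 wmu; have hE := conj_epi_closed_convex hh c0.
have w0 := residual_last_le0 b hh c0.
rewrite -[X in mu + X]opprK; apply: (perspective_le hh c0).
- by apply: le_lt_trans wmu; rewrite oppr_ge0.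
- exact: ltW.
move=> a Ea; have := proj_dot hE b Ea; rewrite dotvBr subr_le0.
by rewrite dotv_pair dotvC mulNr opprK.
Qed.

(** Both functions are tested at the same slope [mu^-1 *: lsubmx w]: [h] through [z], [h'] through
    the projection of [z]. *)
Lemma sqr_dist_conj_epi_le c c' h h' z mu (w := z - proj (conj_epi h') z) :
  convex_lip c h -> 0 <= c -> convex_lip c' h' -> 0 <= c' -> conj_epi h z ->
  - last_coord w < mu ->
  enorm w ^+ 2 <= (mu + last_coord w) * (last_coord z + h' 0) +
    mu * (h (mu^-1 *: lsubmx w) - h' (mu^-1 *: lsubmx w)).
Proof.
move=> hh c0 hh' c0' Ez wmu.
have := residual_perspective_le hh' c0' wmu; rewrite -/w.
have w0 : last_coord w <= 0 := residual_last_le0 z hh' c0'.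
have mu0 : 0 < mu by lra.
have /(ler_wpM2l (ltW mu0)) := Ez (mu^-1 *: lsubmx w).
rewrite dotvZr mulrBr mulVKf ?gt_eqF//.
have -> : enorm w ^+ 2 = dotv w z - dotv w (proj (conj_epi h') z).
  by rewrite -dotvBr sqr_enorm.
rewrite (dotv_pair w z) (dotvC (lsubmx w)).
by clear; lra.
Qed.

(** As [mu] decreases to [- last_coord w], the previous bound tends to at most [kappa (|last_coord
    w| + |lsubmx w|) <= 2 kappa |w|]. *)
Lemma dist_conj_epi_le c c' h h' (kappa : R) z :
  convex_lip c h -> 0 <= c -> convex_lip c' h' -> 0 <= c' -> 0 <= kappa ->
  (forall q, h q - h' q <= kappa * (1 + enorm q)) -> conj_epi h z ->
  dist (conj_epi h') z <= 2 * kappa.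
Proof.
move=> hh c0 hh' c0' kappa0 hh'k Ez; rewrite /dist; set w := z - _.
have [->|w0] := eqVneq (enorm w) 0; first by rewrite mulr_ge0.
have {}w0 : 0 < enorm w by rewrite lt0r w0 enorm_ge0.
rewrite -(ler_pM2l w0) -expr2.
apply/ler_addgt0Pr => e e0.
pose X := last_coord z + h' 0 + kappa.
have X0 : 0 < `|X| + 1 by rewrite ltr_wpDl.
(* The excess of [mu] over [- last_coord w]; its total cost [d * X] is kept below [e]. *)
pose d := e / (`|X| + 1); have d0 : 0 < d by rewrite divr_gt0.
have dX : d * X <= e.
  have <- : d * (`|X| + 1) = e by rewrite divfK// gt_eqF.
  by rewrite ler_wpM2l ?(ltW d0)//; have := ler_norm X; lra.
pose mu := d - last_coord w.
have lw := residual_last_le0 z hh' c0'; rewrite -/w in lw.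
have mu0 : 0 < mu by rewrite /mu; lra.
have lwmu : - last_coord w < mu by rewrite /mu; lra.
apply: le_trans (sqr_dist_conj_epi_le hh c0 hh' c0' Ez lwmu) _; rewrite -/w.
have muE : mu + last_coord w = d by rewrite /mu subrK.
have h1 : mu * (h (mu^-1 *: lsubmx w) - h' (mu^-1 *: lsubmx w)) <=
    kappa * (mu + enorm (lsubmx w)).
  apply: le_trans (ler_wpM2l (ltW mu0) (hh'k _)) _.
  rewrite enormZ gtr0_norm ?invr_gt0// mulrCA mulrDr mulr1 mulVKf ?gt_eqF//.
have h2 : kappa * enorm (lsubmx w) <= kappa * enorm w.
  by rewrite ler_wpM2l// enorm_lsubmx.
have h3 : kappa * (- last_coord w) <= kappa * enorm w.
  rewrite ler_wpM2l//; apply: le_trans (normr_last_coord w).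
  by rewrite -normrN ler_norm.
move: h1 h2 h3 dX; rewrite muE /X /mu; lra.
Qed.

(** With [mu = eps |w| - last_coord w] the tested slope has norm at most [eps^-1], so closeness on a
    ball is enough; the tilt costs [eps * (last_coord z + h' 0)]. *)
Lemma dist_conj_epi_local c c' h h' (eps delta : R) z :
  convex_lip c h -> 0 <= c -> convex_lip c' h' -> 0 <= c' -> 0 < eps ->
  (forall q, enorm q <= eps^-1 -> `|h q - h' q| <= delta) -> conj_epi h z ->
  dist (conj_epi h') z <= eps * (last_coord z + h' 0) + (1 + eps) * delta.
Proof.
move=> hh c0 hh' c0' e0 hh'd Ez; rewrite /dist; set w := z - _.
have d0 : `|h 0 - h' 0| <= delta by apply: hh'd; rewrite enorm0 invr_ge0 ltW.
have [->|w0] := eqVneq (enorm w) 0.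
  have /(ler_wpM2l (ltW e0)) : - delta <= last_coord z + h' 0.
    have := conj_epi_last_ge Ez; move: d0; rewrite ler_norml => /andP[_ ?]; lra.
  have := le_trans (normr_ge0 _) d0; lra.
have {}w0 : 0 < enorm w by rewrite lt0r w0 enorm_ge0.
have ew0 : 0 < eps * enorm w by rewrite mulr_gt0.
pose mu := eps * enorm w - last_coord w.
have lw := residual_last_le0 z hh' c0'; rewrite -/w in lw.
have mu0 : 0 < mu by rewrite /mu; lra.
have lwmu : - last_coord w < mu by rewrite /mu; lra.
have := sqr_dist_conj_epi_le hh c0 hh' c0' Ez lwmu; rewrite -/w.
have -> : mu + last_coord w = eps * enorm w by rewrite /mu subrK.
have muw : mu <= (1 + eps) * enorm w.
  by have := normr_last_coord w; rewrite ler_norml /mu => /andP[? _]; lra.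
have qe : enorm (mu^-1 *: lsubmx w) <= eps^-1.
  rewrite enormZ gtr0_norm ?invr_gt0// ler_pdivrMl// ler_pdivlMr//.
  have := ler_wpM2l (ltW e0) (enorm_lsubmx w); rewrite /mu; lra.
have h1 : mu * (h (mu^-1 *: lsubmx w) - h' (mu^-1 *: lsubmx w)) <=
    (1 + eps) * enorm w * delta.
  apply: le_trans (ler_wpM2l (ltW mu0) _) _; last first.
    by apply: ler_wpM2r muw; exact: le_trans d0.
  exact: le_trans (ler_norm _) (hh'd _ qe).
move=> h2; rewrite -(ler_pM2l w0) -expr2; lra.
Qed.

(** Compares [b] with an almost lowest point of the epigraph: its height is near [- h 0], the
    infimum of the conjugate, and its slope is at most [c]. *)
Lemma dist_conj_epi_bound c h b : convex_lip c h -> 0 <= c ->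
  dist (conj_epi h) b <= enorm b + c + `|h 0|.
Proof.
move=> hh c0; have hE := conj_epi_closed_convex hh c0.
apply/ler_addgt0Pr => e e0.
have [z [Ez]] : exists a, conj_epi h a /\ h 0 - e < dotv (lsubmx a) 0 - last_coord a.
  by apply: (conj_epi_above hh c0); lra.
rewrite dotv0 add0r => hz.
have zc := conj_epi_slope_le hh c0 Ez; have z0 := conj_epi_last_ge Ez.
have zE : `|last_coord z| <= `|h 0| + e.
  rewrite ler_norml; have := ler_norm (h 0); have := ler_norm (- h 0).
  by rewrite normrN => ? ?; apply/andP; split; lra.
apply: le_trans (dist_le hE _ Ez) _; apply: le_trans (enormD _ _) _.
rewrite enormN; have := enorm_pair_le z; lra.
Qed.

Lemma halfspace_dist_le c h b q : convex_lip c h -> 0 <= c ->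
  dotv q (lsubmx b) - last_coord b - h q <=
  dist (conj_epi h) b * enorm (pair_rV q (-1)).
Proof.
move=> hh c0; have hE := conj_epi_closed_convex hh c0.
have := proj_in hE b q; have := dotv_le (b - proj (conj_epi h) b) (pair_rV q (-1)).
rewrite dotv_pair lsubmx_pair last_coord_pair lsubmxB last_coordB dotvBl.
rewrite -/(dist _ _) (dotvC q); lra.
Qed.

(** With [halfspace_dist_le], the distance is the supremum over [q]. It need not be attained, since
    the residual may be horizontal, so the normal is tilted to [(lsubmx w, - mu)]. *)
Lemma halfspace_dist_gt c h b s : convex_lip c h -> 0 <= c -> 0 <= s ->
  s < dist (conj_epi h) b ->
  exists q, s * enorm (pair_rV q (-1)) < dotv q (lsubmx b) - last_coord b - h q.
Proof.
move=> hh c0 s0 sd; have hE := conj_epi_closed_convex hh c0.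
set d := dist _ _ in sd; have d0 : 0 < d := le_lt_trans s0 sd.
pose w := b - proj (conj_epi h) b.
have lw : last_coord w <= 0 := residual_last_le0 b hh c0.
pose X := `|last_coord b + h 0| + s + 1.
have X0 : 0 < X by rewrite /X; have := normr_ge0 (last_coord b + h 0); lra.
(* The tilt costs at most [e * (|last_coord b + h 0| + s)], less than [e * X = d (d - s)]. *)
pose e := d * (d - s) / X.
have e0 : 0 < e by rewrite divr_gt0// mulr_gt0// subr_gt0.
have eX : e * X = d * (d - s) by rewrite divfK// gt_eqF.
pose mu := e - last_coord w.
have mu0 : 0 < mu by rewrite /mu; lra.
have lwmu : - last_coord w < mu by rewrite /mu; lra.
exists (mu^-1 *: lsubmx w).
rewrite -(ltr_pM2l mu0).
have -> : mu * (s * enorm (pair_rV (mu^-1 *: lsubmx w) (-1))) =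
    s * enorm (pair_rV (lsubmx w) (- mu)).
  rewrite mulrCA; congr (_ * _); rewrite -[X in X * _]gtr0_norm// -enormZ pair_rVZ.
  by rewrite scalerA divff ?gt_eqF// scale1r mulrN1.
have nrm : enorm (pair_rV (lsubmx w) (- mu)) <= d + e.
  have -> : pair_rV (lsubmx w) (- mu) = w + pair_rV 0 (- e).
    by rewrite -pair_rV_shift /mu opprB.
  apply: le_trans (enormD _ _) _; rewrite lerD2l.
  apply: le_trans (enorm_pair_le _) _; rewrite lsubmx_pair last_coord_pair enorm0 add0r.
  by rewrite normrN gtr0_norm.
have := residual_perspective_le hh c0 lwmu; rewrite -/w.
have -> : mu + last_coord w = e by rewrite /mu subrK.
have dw : d ^+ 2 = dotv w b - dotv w (proj (conj_epi h) b) by rewrite -dotvBr -sqr_enorm.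
have wb : dotv w b = dotv (lsubmx w) (lsubmx b) + last_coord w * last_coord b.
  exact: dotv_pair.
rewrite !mulrBr dotvZl mulVKf ?gt_eqF//.
have -> : mu * last_coord b = e * last_coord b - last_coord w * last_coord b.
  by rewrite /mu mulrBl.
move=> h1; have h2 := ler_wpM2l s0 nrm.
have h3 : e * (last_coord b + h 0) <= e * `|last_coord b + h 0|.
  by rewrite ler_wpM2l ?(ltW e0)// ler_norm.
by move: eX dw wb h1 h2 h3; rewrite /X; clear -e0; lra.
Qed.

End conjugate_epigraph.

(** * Measurable dependence on a parameter *)

Lemma half_pow_dist_cvg {R : realType} (u : nat -> R) (l c : R) :
  (forall k, `|l - u k| <= c * 2^-1 ^+ k) -> u @ \oo --> l.
Proof.
move=> h; apply: (@squeeze_cvgr _ _ _ _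
  (fun k => l - c * 2^-1 ^+ k) (fun k => l + c * 2^-1 ^+ k)).
- by apply: nearW => k; rewrite -ler_distlC.
- by rewrite -[X in _ --> X]subr0; apply: cvgB; [exact: cvg_cst|exact: cvg_half_pow].
- by rewrite -[X in _ --> X]addr0; apply: cvgD; [exact: cvg_cst|exact: cvg_half_pow].
Qed.

Section measurability.
Context {R : realType} {n : nat} {d : measure_display} {T : measurableType d}.
Variables (D : set T) (h : T -> 'rV[R]_n -> R) (c : T -> R).
Hypothesis h_meas : forall p, measurable_fun D (h ^~ p).
Hypothesis h_convex_lip : forall t, D t -> convex_lip (c t) (h t).
Hypothesis c_ge0 : forall t, D t -> 0 <= c t.

Let E t := conj_epi (h t).

Let E_closed_convex t : D t -> closed_convex (E t).
Proof. by move=> Dt; exact: conj_epi_closed_convex (h_convex_lip Dt) (c_ge0 Dt). Qed.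

(** An enumeration of the rational vectors, repeating [0] at the numbers that code no vector. *)
Definition rat_vector (k : nat) : 'rV[R]_n :=
  map_mx ratr (odflt 0 (unpickle k : option 'rV[rat]_n)).

Lemma rat_vector_dense q (e : R) : 0 < e -> exists k, enorm (q - rat_vector k) < e.
Proof.
move=> e0; have s0 : 0 < Num.sqrt n%:R + 1 :> R by rewrite ltr_wpDl ?sqrtr_ge0.
pose r := e / (Num.sqrt n%:R + 1); have r0 : 0 < r by rewrite divr_gt0.
have /choice[y hy] : forall i : 'I_n, exists y : rat, `|q 0 i - ratr y| <= r.
  move=> i; have : q 0 i - r < q 0 i + r by lra.
  move=> /rat_in_itvoo[y]; rewrite in_itv/= => /andP[y1 y2]; exists y.
  by rewrite ler_norml; apply/andP; split; lra.
exists (pickle (\row_i y i : 'rV[rat]_n)); rewrite /rat_vector pickleK/=.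
apply: le_lt_trans (enorm_le_entries (ltW r0) _) _ => [i|]; first by rewrite !mxE.
have <- : (Num.sqrt n%:R + 1) * r = e by rewrite mulrC divfK// gt_eqF.
by rewrite ltr_pM2r// ltrDl.
Qed.

Let halfspace_dist (b : 'rV[R]_(n + 1)) k t : R :=
  Num.max 0 ((dotv (rat_vector k) (lsubmx b) - last_coord b - h t (rat_vector k)) /
             enorm (pair_rV (rat_vector k) (-1))).

Let pair_gt0 (q : 'rV[R]_n) : 0 < enorm (pair_rV q (-1)).
Proof.
apply: lt_le_trans (normr_last_coord _).
by rewrite last_coord_pair normrN normr1.
Qed.

Let halfspace_dist_ub t b k : D t -> halfspace_dist b k t <= dist (E t) b.
Proof.
move=> Dt; rewrite /halfspace_dist ge_max dist_ge0/= ler_pdivrMr//.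
exact: halfspace_dist_le (h_convex_lip Dt) (c_ge0 Dt).
Qed.

(** The inequality of [halfspace_dist_gt] is strict and its gap is Lipschitz in [q] with constant
    below [L], so a rational slope will do. The index [0] makes [sups] the supremum of the whole
    sequence. *)
Let dist_sups t b : D t -> dist (E t) b = sups (fun k => halfspace_dist b k t) 0.
Proof.
move=> Dt; have ub : has_ubound (range (fun k => halfspace_dist b k t)).
  by exists (dist (E t) b) => _ [k _ <-]; exact: halfspace_dist_ub.
have le_sups k : halfspace_dist b k t <= sups (fun k => halfspace_dist b k t) 0.
  by apply: ub_le_sup; [exact: has_ubound_sdrop|exists k].
apply/eqP; rewrite eq_le; apply/andP; split; last first.
  apply: ge_sup; first by exists (halfspace_dist b 0 t), 0%N.
  by move=> _ [k _ <-]; exact: halfspace_dist_ub.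
rewrite leNgt; apply/negP; set s := sups _ _ => sd.
have s0 : 0 <= s by apply: le_trans (le_sups 0%N); rewrite le_max lexx.
have [q hq] := halfspace_dist_gt (h_convex_lip Dt) (c_ge0 Dt) s0 sd.
have [_ hlip] := h_convex_lip Dt.
pose L := enorm (lsubmx b) + c t + s + 1.
have L0 : 0 < L.
  by rewrite /L; have := enorm_ge0 (lsubmx b); have := c_ge0 Dt; lra.
pose g := dotv q (lsubmx b) - last_coord b - h t q - s * enorm (pair_rV q (-1)).
have g0 : 0 < g by rewrite subr_gt0.
have [k qk] := rat_vector_dense q (divr_gt0 g0 L0).
have := le_sups k; rewrite -/s leNgt => /negP; apply.
rewrite /halfspace_dist lt_max; apply/orP; right; rewrite ltr_pdivlMr//.
move: (rat_vector k) qk => q'; rewrite ltr_pdivlMr// /L /g.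
have := hlip q' q; have := normr_dotv_le (q - q') (lsubmx b).
have := enorm_subl (pair_rV q' (-1)) (pair_rV q (-1)).
have := enorm_pair_le (pair_rV q' (-1) - pair_rV q (-1)).
rewrite pair_rVB lsubmx_pair last_coord_pair subrr normr0 addr0.
rewrite (enormB q' q) dotvBl !ler_norml.
move: (enorm_ge0 (q - q')); move: (enorm (q - q')) => y y0.
move=> h1 h2 /andP[_ h3] /andP[_ h4].
have h5 := ler_wpM2l s0 (le_trans h2 (lerD h1 (lexx _))).
clear -y0 h3 h4 h5; lra.
Qed.

Let measurable_coord (b : T -> 'rV[R]_(n + 1)) :=
  forall i, measurable_fun D (fun t => b t 0 i).

(** The point [b] moves with [t] because the half-side of the cube depends on [t]. *)
Lemma measurable_dist_conj_epi (b : T -> 'rV[R]_(n + 1)) :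
  measurable_coord b -> measurable_fun D (fun t => dist (E t) (b t)).
Proof.
move=> mb; apply: (@eq_measurable_fun _ _ _ _ _
  (fun t => sups (fun k => halfspace_dist (b t) k t) 0)).
  by move=> t; rewrite inE => Dt; rewrite dist_sups.
apply: (@measurable_fun_sups _ _ _ _ (fun k t => halfspace_dist (b t) k t)).
  by move=> t Dt; exists (dist (E t) (b t)) => _ [k _ <-]; exact: halfspace_dist_ub.
move=> k; apply: measurable_maxr; first exact: measurable_cst.
apply: measurable_funM; last exact: measurable_cst.
apply: measurable_funB => //; apply: measurable_funB.
  under eq_fun do rewrite dotvE; apply: measurable_sum => i; apply: measurable_funM; first exact: measurable_cst.
  by under eq_fun do rewrite mxE; exact: mb.
by rewrite /last_coord; under eq_fun do rewrite mxE; exact: mb.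
Qed.

(** The entries of the residual are limits of difference quotients of the squared distance, so no
    measurable selection theorem is involved. *)
Lemma measurable_proj_conj_epi (b : T -> 'rV[R]_(n + 1)) i :
  measurable_coord b -> measurable_fun D (fun t => proj (E t) (b t) 0 i).
Proof.
move=> mb.
pose s k : R := 2^-1 ^+ k; have s0 k : 0 < s k by rewrite exprn_gt0// invr_gt0.
apply: (@eq_measurable_fun _ _ _ _ _ (fun t => b t 0 i - (b t - proj (E t) (b t)) 0 i)).
  by move=> t _; rewrite !mxE subKr.
apply: measurable_funB => //.
pose u k t : R := (dist (E t) (b t + s k *: delta_mx 0 i) ^+ 2 -
                   dist (E t) (b t - s k *: delta_mx 0 i) ^+ 2) / (4 * s k).
apply: (@measurable_fun_cvg _ _ _ _ u) => [k|t Dt].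
  apply: measurable_funM; last exact: measurable_cst.
  apply: measurable_funB; apply: measurable_funX; apply: measurable_dist_conj_epi => j.
    under eq_fun do rewrite mxE; apply: measurable_funD => //; exact: measurable_cst.
  under eq_fun do rewrite mxE; apply: measurable_funD => //; exact: measurable_cst.
apply: (@half_pow_dist_cvg _ _ _ 1) => k; rewrite mul1r.
have := residual_diff_quotient (E_closed_convex Dt) (b t) i (s0 k).
exact.
Qed.

Lemma measurable_signed_mean {m : nat} (ws : seq 'rV[R]_m) (F : T -> 'rV[R]_m -> R) b :
  (forall u, measurable_fun D (F ^~ u)) ->
  measurable_fun D (fun t => signed_mean ws (F t : 'rV[R]_m -> R^o) b : R).
Proof.
move=> mF; elim: ws b => [|w ws IH] b /=; first exact: mF.
apply: measurable_funM; first exact: measurable_cst.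
by apply: measurable_funD; exact: IH.
Qed.

Lemma measurable_selection_conj_epi a i :
  measurable_fun D (fun t => selection (E t) a 0 i).
Proof.
pose r t := dist (E t) a / Num.sqrt (n + 1)%:R.
have mr : measurable_fun D r.
  apply: measurable_funM; last exact: measurable_cst.
  by apply: measurable_dist_conj_epi => j; exact: measurable_cst.
pose F t u := proj (E t) (a + r t *: u).
apply: (@measurable_fun_cvg _ _ _ _ (fun K t => dyadic_mean K (F t) 0 i)) => [K|t Dt].
  rewrite /dyadic_mean; under eq_fun do rewrite signed_mean_entry.
  apply: (@measurable_signed_mean _ _ (fun t u => F t u 0 i)) => u.
  apply: measurable_proj_conj_epi => j; under eq_fun do rewrite !mxE.
  apply: measurable_funD; first exact: measurable_cst.
  by apply: measurable_funM => //; exact: measurable_cst.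
have FL u v : enorm (F t u - F t v) <= `|r t| * enorm (u - v).
  exact: proj_affine_lip (E_closed_convex Dt).
pose C := Num.sqrt (n + 1)%:R * ((n + 1)%:R * `|r t|).
apply: (@half_pow_dist_cvg _ _ _ C) => k; rewrite distrC.
apply: le_trans (dyadic_mean_cvg k (normr_ge0 (r t)) FL).
by have := enorm_entry (dyadic_mean k (F t) - selection (E t) a) i; rewrite !mxE.
Qed.

End measurability.

(** * Continuous dependence on the function *)

Section local_stability.
#[local] Opaque dist conj_epi.
Context {R : realType} {n : nat}.
Implicit Types (h : 'rV[R]_n -> R) (a b : 'rV[R]_(n + 1)).

(** The local comparison is made at the projection of [b] on the epigraph of [h0], whose height is
    at most [enorm b + dist (conj_epi h0) b]; [2] bounds [1 + eps]. *)
Lemma dist_conj_epi_near c0 c h0 h b (eps delta : R) :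
  convex_lip c0 h0 -> 0 <= c0 -> convex_lip c h -> 0 <= c -> 0 < eps <= 1 ->
  (forall q, enorm q <= eps^-1 -> `|h q - h0 q| <= delta) ->
  dist (conj_epi h) b <= dist (conj_epi h0) b +
    eps * (enorm b + dist (conj_epi h0) b + h 0) + 2 * delta.
Proof.
move=> hh0 c00 hh cge0 /andP[e0 e1] hd.
have hE0 := conj_epi_closed_convex hh0 c00; have hE := conj_epi_closed_convex hh cge0.
have d0 : 0 <= delta.
  by apply: le_trans (hd 0 _); rewrite ?normr_ge0// enorm0 invr_ge0 ltW.
have Pz := proj_in hE0 b.
have hd' q : enorm q <= eps^-1 -> `|h0 q - h q| <= delta by move=> /hd; rewrite distrC.
have h1 := dist_conj_epi_local hh0 c00 hh cge0 e0 hd' Pz.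
have h2 := dist_le_via hE (conj_epi h0) b.
have h3 : last_coord (proj (conj_epi h0) b) <= enorm b + dist (conj_epi h0) b.
  apply: le_trans (le_trans (ler_norm _) (normr_last_coord _)) _.
  by have := enorm_subl (proj (conj_epi h0) b) b; rewrite enormB addrC distE.
have h4 : last_coord (proj (conj_epi h0) b) + h 0 <= enorm b + dist (conj_epi h0) b + h 0.
  by rewrite lerD2r.
have h5 := ler_wpM2l (ltW e0) h4.
have h6 := ler_wpM2r d0 e1.
move: h1 h2 h5 h6.
move: (dist _ (proj _ _)) (dist _ b) (dist _ b) (last_coord _) (h 0) (enorm b).
by clear => x y z s t u *; lra.
Qed.

Lemma dist_conj_epi_stable c c' h h' (kappa : R) b :
  convex_lip c h -> 0 <= c -> convex_lip c' h' -> 0 <= c' -> 0 <= kappa ->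
  (forall q, `|h q - h' q| <= kappa * (1 + enorm q)) ->
  `|dist (conj_epi h) b - dist (conj_epi h') b| <= 2 * kappa.
Proof.
move=> hh c0 hh' c0' kappa0 hk.
have hE := conj_epi_closed_convex hh c0; have hE' := conj_epi_closed_convex hh' c0'.
have hk' q : h q - h' q <= kappa * (1 + enorm q) := le_trans (ler_norm _) (hk q).
have hk'' q : h' q - h q <= kappa * (1 + enorm q).
  by apply: le_trans (ler_norm _) _; rewrite distrC.
have h1 := dist_conj_epi_le hh c0 hh' c0' kappa0 hk' (proj_in hE b).
have h2 := dist_conj_epi_le hh' c0' hh c0 kappa0 hk'' (proj_in hE' b).
have := dist_le_via hE (conj_epi h') b; have := dist_le_via hE' (conj_epi h) b.
move: h1 h2; clear.
move: (dist _ (proj _ _)) (dist _ (proj _ _)) (dist _ b) (dist _ b) => x y z t *.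
by rewrite ler_norml; apply/andP; split; lra.
Qed.

Lemma selection_conj_epi_continuous c0 h0 a (eta : R) : (0 < n + 1)%N ->
  convex_lip c0 h0 -> 0 <= c0 -> 0 < eta ->
  exists rho delta : R, 0 < delta /\ forall c h, convex_lip c h -> 0 <= c ->
    (forall q, enorm q <= rho -> `|h q - h0 q| <= delta) ->
    enorm (selection (conj_epi h) a - selection (conj_epi h0) a) <= eta.
Proof.
move=> n0 hh0 c00 eta0; have hE0 := conj_epi_closed_convex hh0 c00.
pose m2 : R := 2 * (n + 1)%:R + 1.
have m20 : 0 < m2 by rewrite /m2 ltr_wpDl// mulr_ge0.
pose eta1 := eta / m2; have eta10 : 0 < eta1 by rewrite divr_gt0.
set E0 := conj_epi h0.
(* [B] bounds [dist E a] for every admissible [h], so it can be fixed beforehand; [X] bounds the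
   factor of [eps] in [dist_conj_epi_near] over the ball of radius [B] around [a]. *)
pose B := 2 * dist E0 a + enorm a + `|h0 0| + 3.
pose X := enorm a + 3 * B + `|h0 0| + 1.
have A0 := enorm_ge0 a; have D0 := dist_ge0 E0 a; have N0 := normr_ge0 (h0 0).
have B0 : 0 < B by rewrite /B; lra.
have X0 : 0 < X by rewrite /X; lra.
pose eps := Num.min 1 (eta1 / (2 * X)).
pose delta := Num.min 1 (eta1 / 4).
have eps0 : 0 < eps by rewrite lt_min ltr01 divr_gt0// mulr_gt0.
have delta0 : 0 < delta by rewrite lt_min ltr01 divr_gt0.
have eps1 : eps <= 1 by rewrite ge_min lexx.
have delta1 : delta <= 1 by rewrite ge_min lexx.
have epsX : eps * X <= eta1 / 2.
  have -> : eta1 / 2 = eta1 / (2 * X) * X by field; rewrite gt_eqF.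
  by rewrite ler_pM2r// ge_min lexx orbT.
have delta4 : delta <= eta1 / 4 by rewrite ge_min lexx orbT.
exists eps^-1, delta; split=> // c h hh cge0 hd.
have hE := conj_epi_closed_convex hh cge0.
have e01 : 0 < eps <= 1 by rewrite eps0 eps1.
have hd' q : enorm q <= eps^-1 -> `|h0 q - h q| <= delta by move=> /hd; rewrite distrC.
have near b := dist_conj_epi_near b hh0 c00 hh cge0 e01 hd.
have near' b := dist_conj_epi_near b hh cge0 hh0 c00 e01 hd'.
set E := conj_epi h in hE near near' *.
have h00 : h 0 <= `|h0 0| + delta.
  have := hd 0; rewrite enorm0 invr_ge0 (ltW eps0) => /(_ isT).
  by rewrite ler_norml => /andP[_ ?]; have := ler_norm (h0 0); lra.
have dEa : dist E a <= B.
  have := near a; have : eps * (enorm a + dist E0 a + h 0) <= enorm a + dist E0 a + `|h0 0| + delta.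
    apply: le_trans (_ : eps * (enorm a + dist E0 a + `|h0 0| + delta) <= _).
      by rewrite ler_pM2l//; lra.
    by rewrite ler_piMl//; lra.
  by rewrite /B; lra.
have dE0a : dist E0 a <= B by rewrite /B; lra.
rewrite -[eta](divfK (lt0r_neq0 m20)) -/eta1 mulrC.
apply: selection_stable => // b.
rewrite le_max => ab.
have {}ab : enorm (b - a) <= B by case/orP: ab => /le_trans; apply.
have bB : enorm b <= enorm a + B by have := enorm_subl b a; lra.
have dEb : dist E b <= 2 * B.
  have := dist_lip hE b a; rewrite ler_norml => /andP[_].
  move: ab dEa; clear; move: (enorm _) (dist _ _) (dist _ _) => x y z; lra.
have dE0b : dist E0 b <= 2 * B.
  have := dist_lip hE0 b a; rewrite ler_norml => /andP[_].
  move: ab dE0a; clear; move: (enorm _) (dist _ _) (dist _ _) => x y z; lra.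
have r1 : eps * (enorm b + dist E0 b + h 0) <= eps * X.
  rewrite ler_pM2l// /X; move: bB dE0b h00 delta1; clear.
  move: (enorm b) (enorm a) (dist _ b) => x y z; lra.
have r2 : eps * (enorm b + dist E b + h0 0) <= eps * X.
  rewrite ler_pM2l// /X; have := ler_norm (h0 0); move: bB dEb; clear.
  move: (enorm b) (enorm a) (dist _ b) => x y z; lra.
have := near b; have := near' b; rewrite ler_norml.
clear -r1 r2 epsX delta4 => n1 n2.
by apply/andP; split; lra.
Qed.

End local_stability.

(** Tube argument: by compactness of the ball, the neighborhoods of [(t0, x0)] obtained for each [q]
    can be replaced by a common one. *)
Lemma near_uniform_ball {R : realType} {n : nat} (I : set R)
    (H : R -> 'rV[R]_n -> 'rV[R]_n -> R) t0 x0 (rho delta : R) :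
  {within [set z : R * ('rV[R]_n * 'rV[R]_n) | I z.1],
    continuous (fun z => H z.1 z.2.1 z.2.2)} ->
  I t0 -> 0 < delta ->
  \forall z \near (t0, x0) : R * 'rV[R]_n, I z.1 ->
    forall q, enorm q <= rho -> `|H z.1 z.2 q - H t0 x0 q| <= delta.
Proof.
move=> Hcont It0 delta0.
have d2 : 0 < delta / 2 by rewrite divr_gt0.
pose K := [set q : 'rV[R]_n | enorm q <= rho].
have cK : compact K.
  apply: bounded_closed_compact.
    exists rho; split; first exact: num_real.
    move=> M rM q /= qr; apply: le_trans (mx_norm_le_enorm q) _.
    exact: le_trans qr (ltW rM).
  have -> : K = (fun q => enorm (0 - q)) @^-1` [set s | s <= rho].
    by apply/seteqP; split => q; rewrite /K /= sub0r enormN.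
  apply: closed_comp; last exact: closed_le.
  by move=> q _; exact: continuous_enorm_dist.
move/compact_near_coveringP : cK.
move=> /(_ _ (nbhs ((t0, x0) : R * 'rV[R]_n))
  (fun z q => I z.1 -> `|H z.1 z.2 q - H t0 x0 q| <= delta) (nbhs_filter _)).
have cover : forall q, K q -> \forall q' \near q & z \near ((t0, x0) : R * 'rV[R]_n),
    I z.1 -> `|H z.1 z.2 q' - H t0 x0 q'| <= delta.
  move=> q Kq.
  have := (subspace_continuousP _ _).1 Hcont (t0, (x0, q)) It0.
  move/(@cvgrPdist_lt _ _ _ _ _) => /(_ _ d2).
  rewrite /= near_withinE.
  case=> -[U1 U2] /= [t0U [[V1 V2] /= [x0V qV] VU]] UU.
  exists (V2, U1 `*` V1) => /=.
    split=> //; exists (U1, V1) => //.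
  move=> [q' [t x]] /= [V2q' [U1t V1x]] It.
  have h1 : `|H t0 x0 q - H t x q'| < delta / 2 :=
    UU (t, (x, q')) (conj U1t (VU (x, q') (conj V1x V2q'))) It.
  have h2 : `|H t0 x0 q - H t0 x0 q'| < delta / 2 :=
    UU (t0, (x0, q')) (conj (nbhs_singleton t0U)
    (VU (x0, q') (conj (nbhs_singleton x0V) V2q'))) It0.
  move: h1 h2 => /=; rewrite !ltr_norml ler_norml => /andP[? ?] /andP[? ?].
  by apply/andP; split; lra.
move=> /(_ cover); apply: filterS => z zK Iz q qr; exact: zK.
Qed.

(** * The Hamiltonian *)

Section hamiltonian.
Context {R : realType} {n : nat}.
Variable H : R -> 'rV[R]_n -> 'rV[R]_n -> R.

Lemma Hstar_le t x v (r : R) :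
  (Hstar H t x v <= r%:E)%E <-> forall p, dotv v p - H t x p <= r.
Proof.
split=> [vr p|vr].
  rewrite -lee_fin; apply: le_trans vr; apply: ereal_sup_ubound.
  by exists p.
by apply: ge_ereal_sup => _ [p _ <-]; rewrite lee_fin.
Qed.

Lemma epiHstarE t x : epiHstar H t x = conj_epi (H t x).
Proof. by apply/seteqP; split => a /Hstar_le. Qed.

Lemma domHstarP t x v :
  domHstar H t x v <-> exists r, conj_epi (H t x) (pair_rV v r).
Proof.
split=> [vfin|[r vr]].
  exists (fine (Hstar H t x v)); rewrite /conj_epi /= lsubmx_pair last_coord_pair.
  apply/Hstar_le; rewrite fineK// fin_numE; apply/andP; split; last first.
    by apply/eqP => vE; move: vfin; rewrite /domHstar /= vE ltxx.
  (* The choice [p = 0] rules out the value [-oo]. *)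
  have : (Hstar H t x v >= (dotv v 0 - H t x 0)%:E)%E.
    by apply: ereal_sup_ubound; exists 0.
  by apply: contraTneq => ->; rewrite -ltNge ltNyr.
rewrite /domHstar /=; apply: (@le_lt_trans _ _ r%:E); last exact: ltry.
by apply/Hstar_le => p; have := vr p; rewrite lsubmx_pair last_coord_pair.
Qed.

(** Biconjugation: points of the epigraph are affine minorants of [H t x], and [conj_epi_above]
    makes them arbitrarily close at [p]. *)
Lemma conj_epi_sup c t x p : convex_lip c (H t x) -> 0 <= c ->
  (H t x p)%:E =
  ereal_sup [set (dotv p (lsubmx a) - last_coord a)%:E | a in conj_epi (H t x)].
Proof.
move=> hH c0; apply/eqP; rewrite eq_le; apply/andP; split; last first.
  apply: ge_ereal_sup => _ [a Ea <-]; rewrite lee_fin dotvC.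
  by have := Ea p; lra.
apply/lee_addgt0Pr => e e0.
have [a [Ea ha]] : exists a, conj_epi (H t x) a /\
    H t x p - e < dotv (lsubmx a) p - last_coord a.
  by apply: (conj_epi_above hH c0); lra.
apply: (@le_trans _ _ ((dotv p (lsubmx a) - last_coord a)%:E + e%:E)%E).
  by rewrite -EFinD lee_fin dotvC; lra.
by rewrite leeD2r//; apply: ereal_sup_ubound; exists a.
Qed.

End hamiltonian.

Lemma within_continuous_time {R : realType} {m n : nat} {V : normedModType R} (I : set R)
    (F : R -> 'rV[R]_n -> 'rV[R]_m -> V) :
  (forall t x a (e : R), I t -> 0 < e ->
     \forall z \near ((t, (x, a)) : R * ('rV[R]_n * 'rV[R]_m)),
       I z.1 -> `|F t x a - F z.1 z.2.1 z.2.2| < e) ->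
  {within [set z : R * ('rV[R]_n * 'rV[R]_m) | I z.1],
    continuous (fun z => F z.1 z.2.1 z.2.2)}.
Proof.
move=> FI; apply/subspace_continuousP => -[t [x a]] /= It.
apply/(@cvgrPdist_lt _ _ _ _ _) => e e0; rewrite near_withinE.
exact: FI.
Qed.

Lemma quarter_sum_lt {R : realType} (eps u v w : R) : 0 < eps ->
  u <= eps / 4 -> v <= 2 * w -> w < eps / 4 -> u + v < eps.
Proof. lra. Qed.

(** With [m >= 1], the set contributes [(4 m + 2) w <= 6 m w] and the point [2 p <= 2 m p]; [10 m]
    leaves room. *)
Lemma lip_constant_le {R : realType} (m w p q s : R) : 1 <= m -> 0 <= w -> 0 <= p ->
  s <= 2 * p -> q <= (2 * m + 1) * (2 * w) -> s + q <= 10 * m * (w + p).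
Proof.
move=> m1 w0 p0; have : w <= m * w by rewrite ler_peMl.
have : p <= m * p by rewrite ler_peMl.
lra.
Qed.

(** * The selection on the epigraphs of [H^*(t, x, .)] *)

Section parametrization.
Context {R : realType} {n : nat} (T : R).
Variables (H : R -> 'rV[R]_n -> 'rV[R]_n -> R) (c : R -> R) (k : R -> R -> R).
Hypothesis H1 : forall x p, lebesgue_measurable_on `[0, T] (fun t => H t x p).
Hypothesis H3 : forall t x, t \in `[0, T] -> convex_fun_rV (H t x).
Hypothesis Hc_ge0 : forall t, t \in `[0, T] -> 0 <= c t.
Hypothesis H4 : forall t x p q, t \in `[0, T] ->
  `|H t x p - H t x q| <= c t * (1 + enorm x) * enorm (p - q).
Hypothesis Hk_ge0 : forall r t, 0 < r -> t \in `[0, T] -> 0 <= k r t.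
Hypothesis HLC : forall r t x y p, 0 < r -> t \in `[0, T] ->
  x \in cball0 r -> y \in cball0 r ->
  `|H t x p - H t y p| <= k r t * (1 + enorm p) * enorm (x - y).

#[local] Opaque selection.

Let e t x a := selection (conj_epi (H t x)) a.

Lemma slope_bound_ge0 t (x : 'rV[R]_n) : t \in `[0, T] -> 0 <= c t * (1 + enorm x).
Proof. by move=> tT; rewrite mulr_ge0 ?Hc_ge0// addr_ge0// enorm_ge0. Qed.

Lemma hamiltonian_convex_lip t x : t \in `[0, T] -> convex_lip (c t * (1 + enorm x)) (H t x).
Proof. by move=> tT; split=> [|p q]; [exact: H3|exact: H4]. Qed.

Lemma epi_closed_convex t x : t \in `[0, T] -> closed_convex (conj_epi (H t x)).
Proof.
move=> tT.
exact: conj_epi_closed_convex (hamiltonian_convex_lip x tT) (slope_bound_ge0 x tT).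
Qed.

Let dim_gt0 : (0 < n + 1)%N. Proof. by rewrite addn1. Qed.

Lemma parametrization_in t x a : t \in `[0, T] -> conj_epi (H t x) (e t x a).
Proof. by move=> tT; apply: selection_in; exact: epi_closed_convex. Qed.

Lemma parametrization_id t x a : t \in `[0, T] -> conj_epi (H t x) a -> e t x a = a.
Proof. by move=> tT; apply: selection_id; exact: epi_closed_convex. Qed.

Lemma parametrization_measurable x a i :
  lebesgue_measurable_on `[0, T] (fun t => e t x a 0 i).
Proof.
apply: (@measurable_selection_conj_epi _ _ _ (lebR R) _ (fun t => H t x)
  (fun t => c t * (1 + enorm x))) => [p|t tT|t tT]; first exact: H1.
- exact: hamiltonian_convex_lip (mem_set tT).
- exact: slope_bound_ge0 (mem_set tT).
Qed.

Lemma parametrization_lip r t x y a b : 0 < r -> t \in `[0, T] ->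
  x \in cball0 r -> y \in cball0 r ->
  enorm (e t x a - e t y b) <=
    10 * (n + 1)%:R * (k r t * enorm (x - y) + enorm (a - b)).
Proof.
move=> r0 tT xr yr; set kappa := k r t * enorm (x - y).
have kappa0 : 0 <= kappa by rewrite mulr_ge0 ?Hk_ge0// enorm_ge0.
have Hxy q : `|H t x q - H t y q| <= kappa * (1 + enorm q).
  by apply: le_trans (HLC q r0 tT xr yr) _; rewrite /kappa mulrAC.
have h1 : enorm (e t x b - e t y b) <= (2 * (n + 1)%:R + 1) * (2 * kappa).
  apply: selection_stable => //; try exact: epi_closed_convex.
  move=> z _; apply: (dist_conj_epi_stable z) kappa0 Hxy.
  - exact: hamiltonian_convex_lip.
  - exact: slope_bound_ge0.
  - exact: hamiltonian_convex_lip.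
  - exact: slope_bound_ge0.
have h2 : enorm (e t x a - e t x b) <= 2 * enorm (a - b).
  by apply: selection_lip => //; exact: epi_closed_convex.
have m1 : 1 <= (n + 1)%:R :> R by rewrite ler1n.
apply: le_trans (enorm_distD (e t x b) _ _) _.
exact: lip_constant_le m1 kappa0 (enorm_ge0 _) h2 h1.
Qed.

(** The point moves by at most twice its distance to the epigraph, and that distance is at most
    [enorm a + c t * (1 + enorm x) + |H t x 0|]; hence the factors 2, 2 and 3. *)
Lemma parametrization_bound t x a : t \in `[0, T] ->
  enorm (e t x a) <= 2 * `|H t x 0| + 2 * c t * (1 + enorm x) + 3 * enorm a.
Proof.
move=> tT; apply: le_trans (enorm_subl _ a) _.
have := selection_dist dim_gt0 a (epi_closed_convex x tT); rewrite -/(e t x a).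
have := dist_conj_epi_bound a (hamiltonian_convex_lip x tT) (slope_bound_ge0 x tT).
by move: (enorm _) (enorm _) (enorm _) (dist _ _) => *; lra.
Qed.

Lemma parametrization_continuous t x a (eps : R) : t \in `[0, T] -> 0 < eps ->
  \forall z \near ((x, a) : 'rV[R]_n * 'rV[R]_(n + 1)),
    enorm (e t x a - e t z.1 z.2) < eps.
Proof.
move=> tT eps0; pose r := enorm x + 1.
have r0 : 0 < r by rewrite ltr_wpDl ?enorm_ge0.
pose C := 10 * (n + 1)%:R * (k r t + 1).
have C0 : 0 < C.
  by rewrite !mulr_gt0// ltr_wpDl ?Hk_ge0.
(* The [1] keeps [y] in the ball of radius [r], where [k r t] applies. *)
pose d := Num.min 1 (eps / C); have d0 : 0 < d by rewrite lt_min ltr01 divr_gt0.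
exists ([set y | enorm (x - y) < d], [set b | enorm (a - b) < d]) => /=.
  by split; exact: near_enorm.
move=> [y b] [/= xy ab].
have xr : x \in cball0 r by rewrite inE /cball0 /= lerDl.
have yr : y \in cball0 r.
  rewrite inE /cball0 /=; have := enorm_subl y x; rewrite enormB.
  by move: xy; rewrite lt_min => /andP[? _]; rewrite /r; lra.
apply: le_lt_trans (parametrization_lip a b r0 tT xr yr) _.
have -> : eps = 10 * (n + 1)%:R * ((k r t + 1) * (eps / C)).
  by rewrite mulrA -/C mulrC divfK// gt_eqF.
rewrite ltr_pM2l ?mulr_gt0//.
move: xy ab; rewrite !lt_min => /andP[_ /ltW xy] /andP[_ ab].
by rewrite mulrDl mul1r ler_ltD// ler_wpM2l// Hk_ge0.
Qed.

(** The Lipschitz bound cannot give continuity in [t]. Here [(t, x)] varies with [a] fixed, at a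
    cost of [eps / 4], and then [a] varies with the Lipschitz constant 2 common to all epigraphs. *)
Lemma parametrization_jointly_continuous t x a (eps : R) :
  {within [set z : R * ('rV[R]_n * 'rV[R]_n) | z.1 \in `[0, T]],
     continuous (fun z => H z.1 z.2.1 z.2.2)} ->
  t \in `[0, T] -> 0 < eps ->
  \forall z \near ((t, (x, a)) : R * ('rV[R]_n * 'rV[R]_(n + 1))),
    z.1 \in `[0, T] -> enorm (e t x a - e z.1 z.2.1 z.2.2) < eps.
Proof.
move=> Hcont tT eps0; have eps4 : 0 < eps / 4 by rewrite divr_gt0.
have [rho [delta [delta0 near_e]]] :=
  selection_conj_epi_continuous a dim_gt0 (hamiltonian_convex_lip x tT) (slope_bound_ge0 x tT) eps4.
have [[U1 U2] /= [tU xU] UH] :=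
  @near_uniform_ball R n [set s | s \in `[0, T]] H t x rho delta Hcont tT delta0.
exists (U1, U2 `*` [set b | enorm (a - b) < eps / 4]) => /=.
  by split=> //; exists (U2, [set b | enorm (a - b) < eps / 4]) => //=;
     split=> //; exact: near_enorm.
move=> [s [y b]] /= [Us [Uy ab]] sT.
have h1 := near_e _ _ (hamiltonian_convex_lip y sT) (slope_bound_ge0 y sT)
  (UH (s, y) (conj Us Uy) sT).
have h2 := selection_lip dim_gt0 a b (epi_closed_convex y sT).
apply: le_lt_trans (enorm_distD (e s y a) _ _) _.
rewrite -/(e s y a) -/(e t x a) enormB in h1.
rewrite -/(e s y a) -/(e s y b) in h2.
exact: quarter_sum_lt eps0 h1 h2 ab.
Qed.

End parametrization.

Unset Implicit Arguments.
Set Strict Implicit.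

Theorem theorem4p1 (R : realType) (n : nat) (T : R) (hT : 0 < T)
  (H : R -> 'rV[R]_n -> 'rV[R]_n -> R) (c : R -> R) (k : R -> R -> R)
  (* (H1) *)
  (H1 : forall x p, lebesgue_measurable_on `[0, T] (fun t => H t x p))
  (* (H2) *)
  (H2 : forall t, t \in `[0, T] ->
     continuous (fun z : 'rV[R]_n * 'rV[R]_n => H t z.1 z.2))
  (* (H3) *)
  (H3 : forall t x, t \in `[0, T] -> convex_fun_rV (H t x))
  (* (H4) *)
  (Hc_meas : lebesgue_measurable_on `[0, T] c)
  (Hc_ge0 : forall t, t \in `[0, T] -> 0 <= c t)
  (H4 : forall t x p q, t \in `[0, T] ->
     `|H t x p - H t x q| <= c t * (1 + enorm x) * enorm (p - q))
  (* (HLC) *)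
  (Hk_meas : forall r, 0 < r -> lebesgue_measurable_on `[0, T] (k r))
  (Hk_ge0 : forall r t, 0 < r -> t \in `[0, T] -> 0 <= k r t)
  (HLC : forall r t x y p, 0 < r -> t \in `[0, T] ->
     x \in cball0 r -> y \in cball0 r ->
     `|H t x p - H t y p| <= k r t * (1 + enorm p) * enorm (x - y)) :
  exists (f : R -> 'rV[R]_n -> 'rV[R]_(n + 1) -> 'rV[R]_n)
         (l : R -> 'rV[R]_n -> 'rV[R]_(n + 1) -> R),
    (* measurability in t *)
    (forall x a (i : 'I_n), lebesgue_measurable_on `[0, T] (fun t => f t x a 0 i)) /\
    (forall x a, lebesgue_measurable_on `[0, T] (fun t => l t x a)) /\
    (* continuity in (x,a) *)
    (forall t, t \in `[0, T] ->
       continuous (fun z : 'rV[R]_n * 'rV[R]_(n + 1) => f t z.1 z.2)) /\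
    (forall t, t \in `[0, T] ->
       continuous (fun z : 'rV[R]_n * 'rV[R]_(n + 1) => l t z.1 z.2)) /\
    (* representation *)
    (forall t x p, t \in `[0, T] ->
       (H t x p)%:E =
       ereal_sup [set ((dotv p (f t x a) - l t x a)%:E) | a in [set: 'rV[R]_(n + 1)]]) /\
    (forall t x, t \in `[0, T] ->
       [set f t x a | a in [set: 'rV[R]_(n + 1)]] = domHstar H t x) /\
    (* (A1) *)
    (forall r t x y a b, 0 < r -> t \in `[0, T] ->
       x \in cball0 r -> y \in cball0 r ->
       enorm (f t x a - f t y b) <=
         10 * (n + 1)%:R * (k r t * enorm (x - y) + enorm (a - b)) /\
       `|l t x a - l t y b| <=
         10 * (n + 1)%:R * (k r t * enorm (x - y) + enorm (a - b))) /\
    (* (A2) *)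
    (forall t x a, t \in `[0, T] ->
       enorm (f t x a) <= c t * (1 + enorm x) /\
       - `|H t x 0| <= l t x a /\
       l t x a <= 2 * `|H t x 0| + 2 * c t * (1 + enorm x) + 3 * enorm a) /\
    (* (A3) *)
    (forall t x a, t \in `[0, T] -> a \in epiHstar H t x ->
       a = row_mx (f t x a) (\row_(j < 1) l t x a)) /\
    (* (A4) *)
    ({within [set z : R * ('rV[R]_n * 'rV[R]_n) | z.1 \in `[0, T]],
       continuous (fun z => H z.1 z.2.1 z.2.2)} ->
     {within [set z : R * ('rV[R]_n * 'rV[R]_(n + 1)) | z.1 \in `[0, T]],
       continuous (fun z => f z.1 z.2.1 z.2.2)} /\
     {within [set z : R * ('rV[R]_n * 'rV[R]_(n + 1)) | z.1 \in `[0, T]],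
       continuous (fun z => l z.1 z.2.1 z.2.2)}).
Proof.
pose e t x a := selection (conj_epi (H t x)) a.
have cx_ge0 t (x : 'rV[R]_n) : t \in `[0, T] -> 0 <= c t * (1 + enorm x).
  exact: slope_bound_ge0.
have H_lip t x : t \in `[0, T] -> convex_lip (c t * (1 + enorm x)) (H t x).
  exact: hamiltonian_convex_lip.
have e_in t x a : t \in `[0, T] -> conj_epi (H t x) (e t x a).
  exact: (parametrization_in H3 Hc_ge0 H4).
have e_id t x a : t \in `[0, T] -> conj_epi (H t x) a -> e t x a = a.
  exact: (parametrization_id H3 Hc_ge0 H4).
have e_lsubmx (a b : 'rV[R]_(n + 1)) : `|lsubmx a - lsubmx b| <= enorm (a - b).
  by rewrite -lsubmxB; exact: le_trans (mx_norm_le_enorm _) (enorm_lsubmx _).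
have e_last (a b : 'rV[R]_(n + 1)) : `|last_coord a - last_coord b| <= enorm (a - b).
  by rewrite -last_coordB; exact: normr_last_coord.
exists (fun t x a => lsubmx (e t x a)), (fun t x a => last_coord (e t x a)).
split.
  move=> x a i; have -> : (fun t => lsubmx (e t x a) 0 i) =
      (fun t => e t x a 0 (lshift 1 i)) by apply/funext => t; rewrite mxE.
  exact: (parametrization_measurable H1 H3 Hc_ge0 H4).
split.
  move=> x a; have -> : (fun t => last_coord (e t x a)) =
      (fun t => e t x a 0 (rshift n 0)) by apply/funext => t; rewrite /last_coord mxE.
  exact: (parametrization_measurable H1 H3 Hc_ge0 H4).
have e_cont t x a eps := @parametrization_continuous _ _ T H c k H3 Hc_ge0 H4 Hk_ge0 HLC t x a eps.
split.
  move=> t tT [x a]; apply/(@cvgrPdist_lt _ _ _ _ (nbhs_filter _)) => eps eps0.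
  apply: filterS (e_cont t x a eps tT eps0) => z.
  exact: le_lt_trans (e_lsubmx _ _).
split.
  move=> t tT [x a]; apply/(@cvgrPdist_lt _ _ _ _ (nbhs_filter _)) => eps eps0.
  apply: filterS (e_cont t x a eps tT eps0) => z.
  exact: le_lt_trans (e_last _ _).
split.
  move=> t x p tT; rewrite (conj_epi_sup p (H_lip t x tT) (cx_ge0 t x tT)).
  (* The image of [e t x] is exactly the epigraph, so both suprema run over the same values. *)
  congr ereal_sup; apply/seteqP; split=> _ [a Ea <-].
    by exists a => //; rewrite e_id.
  by exists (e t x a) => //; exact: e_in.
split.
  move=> t x tT; apply/seteqP; split=> v.
    move=> [a _ <-]; apply/domHstarP; exists (last_coord (e t x a)).
    by rewrite -pair_rVE; exact: e_in.
  move=> /domHstarP[r Evr]; exists (pair_rV v r) => //.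
  by rewrite e_id// lsubmx_pair.
split.
  move=> r t x y a b r0 tT xr yr.
  have le_e := parametrization_lip H3 Hc_ge0 H4 Hk_ge0 HLC a b r0 tT xr yr.
  split; last exact: le_trans (e_last _ _) le_e.
  by rewrite -lsubmxB; exact: le_trans (enorm_lsubmx _) le_e.
split.
  move=> t x a tT; split.
    exact: conj_epi_slope_le (H_lip t x tT) (cx_ge0 t x tT) (e_in t x a tT).
  split.
    apply: le_trans (conj_epi_last_ge (e_in t x a tT)).
    by rewrite lerN2 ler_norm.
  apply: le_trans (parametrization_bound H3 Hc_ge0 H4 x a tT).
  exact: le_trans (ler_norm _) (normr_last_coord _).
split.
  move=> t x a tT; rewrite inE epiHstarE => Ea.
  by rewrite e_id// -/(pair_rV _ _) -pair_rVE.
move=> Hcont.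
have e_joint t x a eps :=
  @parametrization_jointly_continuous _ _ T H c H3 Hc_ge0 H4 t x a eps Hcont.
split.
  apply: (within_continuous_time (I := [set t | t \in `[0, T]])
    (F := fun t x a => lsubmx (e t x a))) => t x a eps tT eps0.
  apply: filterS (e_joint t x a eps tT eps0) => z /[apply].
  exact: le_lt_trans (e_lsubmx _ _).
apply: (within_continuous_time (I := [set t | t \in `[0, T]]) (V := R^o)
  (F := fun t x a => last_coord (e t x a))) => t x a eps tT eps0.
apply: filterS (e_joint t x a eps tT eps0) => z /[apply].
exact: le_lt_trans (e_last _ _).
Qed.
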